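(* Let $\mathcal G=(\mathcal V,\mathcal E)$ be an infinite, connected, locally finite metric graph with $j:=\sup_{e\in\mathcal E}l_e<\infty$ and $r:=\inf_{e\in\mathcal E}l_e>0$. Let $x_0\in\mathcal V$ be such that there is a sequence $\{x_n\}\subset\mathcal V$ with $d(x_0,x_n)\to+\infty$ and such that for every $R>0$ the ball $B_R(x_0)$ is finite (consists of finitely many vertices and edges), and assume there is a constant $C_0>0$ with $\sum_{y\sim x}\omega(x,y)\le C_0\,\mu_{\mathcal V}(x)$ for all $x\in\mathcal V$. Put $R_0:=\max\{2j,1\}$. Let $h:\mathcal G\times[0,\infty)\to\mathbb R$ be positive, let $\sigma>1$, and let $\theta_1\ge 2$, $\theta_2\ge 1$, $\theta_1\ge\theta_2$. For $R>0$ set $$E_R:=\{(x,t)\in\mathcal G\times[0,\infty): R^{\theta_1}\le d(x,x_0)^{\theta_1}+t^{\theta_2}\le 2R^{\theta_1}\}.$$ Suppose there exists a constant $C>0$ such that for every $R\ge R_0$ $$\int_0^\infty\Big\{\sum_{x\in\mathcal V}\mu_{\mathcal V}(x)h^{-\frac1{\sigma-1}}(x,t)\mathbf 1_{E_R}(x,t)\Big\}dt\le CR^{\frac{\sigma}{\sigma-1}},\qquad \int_0^\infty\Big\{\sum_{e\in\mathcal E}\int_0^{l_e}h_e^{-\frac1{\sigma-1}}(x,t)\mathbf 1_{E_R}(x,t)\,dx\Big\}dt\le CR^{\frac{\sigma}{\sigma-1}}.$$ Then any nonnegative very weak solution $u:\mathcal G\times[0,\infty)\to\mathbb R$ of $$u_t\ge\Delta_{\mathcal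 G}u+h|u|^\sigma\ \text{ on }\mathcal G\times(0,\infty),\qquad u(x,0)=u_0(x),\ x\in\mathcal G,$$ satisfies $u\equiv0$ on $\mathcal G\times[0,\infty)$.
   Context: Metric graph: $\mathcal V$ and $\mathcal E$ are countable sets of vertices and edges. Each edge $e$ has a length $l_e\in(0,\infty)$ and is identified with $I_e=(0,l_e)$, its closure with $[0,l_e]$, where $0$ corresponds to the initial vertex $i(e)$ and $l_e$ to the final vertex $j(e)$ (the number $j$ and the map $j(\cdot)$ are different objects); the intervals are glued at the vertices. $e\ni x$ means that the vertex $x$ is an endpoint of $e$; $x\sim y$ means that $x,y$ are joined by an edge. Locally finite: every vertex has finite degree. $d$ is the path metric (infimum of lengths of connecting paths), $B_R(x_0)=\{x\in\mathcal G:d(x,x_0)<R\}$. A function $f$ on $\mathcal G$ is identified with the family $(f_e)_{e\in\mathcal E}$, $f_e:[0,l_e]\to\mathbb R$, with values agreeing at common vertices; $f\in C(\mathcal G)$ if each $f_e$ is continuous. Primes denote derivatives in the space variable. $\mu_{\mathcal V}:\mathcal V\to(0,\infty)$ is a vertex measure, and $\omega:\mathcal V\times\mathcal V\to[0,\infty)$ is symmetric with $\omega(x,y)>0$ iff $x\sim y$. Integrals: $\int_{\mathcal G}f\,d\mu_{\mathcal G}:=\sum_{x\in\mathcal V}\mu_{\mathcal V}(x)f(x)+\sum_{e\in\mathcal E}\int_0^{l_e}f_e(x)\,dx$. Laplacian: $\Delta_{\mathcal V}f(x)=\frac1{\mu_{\mathcal V}(x)}\sum_{y\sim x}\omega(x,y)(f(y)-f(x))$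 for $x\in\mathcal V$; $\Delta_{\mathcal E}f=f_e''$ on each $I_e$; $\Delta_{\mathcal G}f$ is understood through $\int_{\mathcal G}g\,\Delta_{\mathcal G}f\,d\mu_{\mathcal G}:=\sum_{x\in\mathcal V}\mu_{\mathcal V}(x)g(x)\Delta_{\mathcal V}f(x)+\sum_{e\in\mathcal E}\int_0^{l_e}g_e f_e''\,dx$. $\mathcal D(\mathcal G)$ is the set of $f\in C(\mathcal G)$ with $f_e\in C^2(I_e)\cap C^1([0,l_e])$ and $f_e''\in L^\infty(I_e)$ for all $e$. The Kirchhoff operator at $x\in\mathcal V$ is $[\mathcal K(f)](x)=\sum_{e\ni x}\frac{df_e(x)}{dn}$, where $\frac{df_e(x)}{dn}=f_e'(x)$ if $j(e)=x$ and $-f_e'(x)$ if $i(e)=x$. Very weak solution of the parabolic problem: $u:\mathcal G\times[0,\infty)\to\mathbb R$ such that (1) for every $x\in\mathcal G$, $u(x,\cdot)\in L^1_{\rm loc}([0,\infty))\cap L^\sigma_{\rm loc}([0,\infty),h(x,\cdot)dt)$; (2) for every $t\ge0$, $u(\cdot,t)\in\mathcal D(\mathcal G)$ and $[\mathcal K(u)](x,t)=0$ for all $x\in\mathcal V$; (3) for every nonnegative $\varphi:\mathcal G\times[0,\infty)\to\mathbb R$ with $\mathrm{supp}\,\varphi\subset A\times[0,T]$ for some $T>0$ and compact $A\subset\mathcal G$, and $\varphi(x,\cdot)\in C^1([0,\infty))$ for all $x\in\mathcal G$, $$\int_0^\infty\!\!\int_{\mathcal G}\varphi\,\Delta_{\mathcal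 G}u\,d\mu_{\mathcal G}dt+\int_0^\infty\!\!\int_{\mathcal G}h|u|^\sigma\varphi\,d\mu_{\mathcal G}dt+\int_0^\infty\!\!\int_{\mathcal G}u\,\varphi_t\,d\mu_{\mathcal G}dt+\int_{\mathcal G}u_0(x)\varphi(x,0)\,d\mu_{\mathcal G}\le0.$$ Here $u_0:\mathcal G\to\mathbb R$ is the given initial datum.
   Formalization: The conclusion reads: for almost every t ≥ 0, u(x,t)=0 for all x (literal u≡0 fails: u=1 at t=1 and 0 otherwise, u_0=0, is a very weak solution); h is taken jointly Borel measurable on each closed edge times [0,∞), and the integrals in the weak inequality are required to converge. *)

(* Defs.v *)
From HB Require Import structures.
From mathcomp Require Import all_boot all_order all_algebra.
From mathcomp Require Import all_classical all_reals all_analysis.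

Set Implicit Arguments.
Unset Strict Implicit.
Unset Printing Implicit Defensive.

Import Order.TTheory GRing.Theory Num.Theory.
Import numFieldNormedType.Exports.

Local Open Scope classical_set_scope.
Local Open Scope ring_scope.

(* Loops and multiple edges are allowed. *)
Record metricGraph (R : realType) := MetricGraph {
  vertex : countType ;
  edge : countType ;
  elen : edge -> R ;
  elen_gt0 : forall e, 0 < elen e ;
  ini : edge -> vertex ;
  ter : edge -> vertex
}.
Arguments ini {R _}.
Arguments ter {R _}.
Arguments elen {R _}.

Definition adj {R : realType} {G : metricGraph R} (x y : vertex G) : Prop :=
  exists e : edge G, (ini e = x /\ ter e = y) \/ (ini e = y /\ ter e = x).

Definition star {R : realType} {G : metricGraph R} (x : vertex G)
  : set (edge G) := [set e | ini e = x \/ ter e = x].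

Definition locally_finite {R : realType} (G : metricGraph R) : Prop :=
  forall x : vertex G, finite_set (star x).

(* As a set, the glued graph is the disjoint union of the vertices and of the
   open edges ]0, elen e[. *)
Inductive gpoint (R : realType) (G : metricGraph R) : Type :=
| Vertex of vertex G
| Inner (e : edge G) of {s : R | 0 < s < elen e}.
Arguments Vertex {R G}.
Arguments Inner {R G}.

(* The point of the closed edge e with coordinate s; coordinates outside
   [0, elen e] are sent to the nearest endpoint. *)
Definition epoint {R : realType} {G : metricGraph R} (e : edge G) (s : R)
  : gpoint G :=
  match insub s : option {s : R | 0 < s < elen e} with
  | Some s' => Inner e s'
  | None => if s <= 0 then Vertex (ini e) else Vertex (ter e)
  end.

(* A function on the graph is a function on its points; this is the associated
   family (f_e), whose values automatically agree at common vertices. *)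
Definition restr {R : realType} {G : metricGraph R} (f : gpoint G -> R)
  (e : edge G) : R -> R := fun s => f (epoint e s).

(* gpath p q L: some path from p to q of total length L is made of finitely
   many segments, each contained in one closed edge. *)
Inductive gpath (R : realType) (G : metricGraph R)
  : gpoint G -> gpoint G -> R -> Prop :=
| gpath0 p : gpath p p 0
| gpathS e s t q L : 0 <= s <= elen e -> 0 <= t <= elen e ->
    gpath (epoint e t) q L -> gpath (epoint e s) q (`|s - t| + L).

Definition gconnected {R : realType} (G : metricGraph R) : Prop :=
  forall p q : gpoint G, exists L, gpath p q L.

Definition gdist {R : realType} {G : metricGraph R} (p q : gpoint G) : R :=
  inf [set L | gpath p q L].

Definition gball {R : realType} {G : metricGraph R} (x : gpoint G) (r : R)
  : set (gpoint G) := [set p | gdist p x < r].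

Definition finitely_many_cells {R : realType} {G : metricGraph R}
  (A : set (gpoint G)) : Prop :=
  finite_set [set x : vertex G | A (Vertex x)] /\
  finite_set [set e : edge G | exists s, A (Inner e s)].

Section PathTopology.
Context {R : realType} {G : metricGraph R}.

(* On a connected graph this is gdist p q < r; this form yields a
   pseudometric without connectedness. *)
Definition path_ball (p : gpoint G) (r : R) (q : gpoint G) : Prop :=
  exists2 L, gpath p q L & L < r.

Lemma gpath_cat (p q r : gpoint G) (K L : R) :
  gpath p q K -> gpath q r L -> gpath p r (K + L).
Proof.
elim=> [p0|e s t q0 K0 s0 t0 _ IH] h; first by rewrite add0r.
by rewrite -addrA; apply: gpathS => //; exact: IH.
Qed.

Lemma gpath_sym (p q : gpoint G) (L : R) : gpath p q L -> gpath q p L.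
Proof.
elim=> [p0|e s t q0 K0 s0 t0 _ IH]; first exact: gpath0.
rewrite addrC distrC -[`|t - s|]addr0; apply: gpath_cat IH _.
by apply: gpathS => //; exact: gpath0.
Qed.

Lemma path_ball_center (p : gpoint G) (r : R) : 0 < r -> path_ball p r p.
Proof. by move=> r0; exists 0 => //; exact: gpath0. Qed.

Lemma path_ball_sym (p q : gpoint G) (r : R) :
  path_ball p r q -> path_ball q r p.
Proof. by move=> [L pq Lr]; exists L => //; exact: gpath_sym. Qed.

Lemma path_ball_triangle (p q s : gpoint G) (r1 r2 : R) :
  path_ball p r1 q -> path_ball q r2 s -> path_ball p (r1 + r2) s.
Proof.
move=> [K pq Kr] [L qs Lr]; exists (K + L); last exact: ltrD.
exact: gpath_cat pq qs.
Qed.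

HB.instance Definition _ := gen_eqMixin (gpoint G).
HB.instance Definition _ := gen_choiceMixin (gpoint G).
HB.instance Definition _ :=
  hasNbhs.Build (gpoint G) (nbhs_ (entourage_ path_ball)).
HB.instance Definition _ := @Nbhs_isPseudoMetric.Build R (gpoint G)
  (entourage_ path_ball) erefl path_ball
  path_ball_center path_ball_sym path_ball_triangle erefl.

End PathTopology.

(* The derivative of f relative to D; it is one-sided at an endpoint of an
   interval D. *)
Definition deriv_in {R : realType} (D : set R) (f : R -> R) (s : R) : R :=
  lim ((f y - f s) / (y - s) @[y --> within D s^']).

Definition C1_in {R : realType} (D : set R) (f : R -> R) : Prop :=
  (forall s, D s -> cvg ((f y - f s) / (y - s) @[y --> within D s^'])) /\
  {within D, continuous (deriv_in D f)}.

Definition C2_open {R : realType} (a b : R) (f : R -> R) : Prop :=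
  forall s, s \in `]a, b[ ->
    [/\ derivable f s 1, derivable (derive1 f) s 1 &
        {for s, continuous (derive1n 2 f)}].

Definition ess_bounded {R : realType} (D : set R) (f : R -> R) : Prop :=
  exists M : R, {ae lebesgue_measure, forall s, D s -> `|f s| <= M}.

Definition domD {R : realType} {G : metricGraph R} (f : gpoint G -> R)
  : Prop :=
  forall e : edge G,
  [/\ {within `[0, elen e], continuous (restr f e)},
      C2_open 0 (elen e) (restr f e),
      C1_in `[0, elen e] (restr f e) &
      ess_bounded `]0, elen e[ (derive1n 2 (restr f e))].

(* For a loop both ends of e are at x, and both contribute. *)
Definition normal_deriv {R : realType} {G : metricGraph R} (f : gpoint G -> R)
  (x : vertex G) (e : edge G) : R :=
  (if ter e == x then deriv_in `[0, elen e] (restr f e) (elen e) else 0) -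
  (if ini e == x then deriv_in `[0, elen e] (restr f e) 0 else 0).

Definition kirchhoff {R : realType} {G : metricGraph R} (f : gpoint G -> R)
  (x : vertex G) : R := \sum_(e \in star x) normal_deriv f x e.

Record weights (R : realType) (G : metricGraph R) := Weights {
  muV : vertex G -> R ;
  muV_gt0 : forall x, 0 < muV x ;
  omega : vertex G -> vertex G -> R ;
  omega_ge0 : forall x y, 0 <= omega x y ;
  omega_sym : forall x y, omega x y = omega y x ;
  omega_gt0 : forall x y, 0 < omega x y <-> adj x y
}.

Section Analysis.
Context {R : realType} {G : metricGraph R} (W : weights G).

Definition laplacianV (f : gpoint G -> R) (x : vertex G) : R :=
  (muV W x)^-1 *
  \sum_(y \in [set y | adj x y]) omega W x y * (f (Vertex y) - f (Vertex x)).

Definition laplacian (f : gpoint G -> R) (p : gpoint G) : R :=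
  match p with
  | Vertex x => laplacianV f x
  | Inner e s => derive1n 2 (restr f e) (val s)
  end.

Definition signed_sum (T : choiceType) (a : T -> \bar R) : \bar R :=
  (\esum_(i in [set: T]) a^\+ i - \esum_(i in [set: T]) a^\- i)%E.

(* Edge integrals are over the open edges, so the values of f at the vertices
   only enter the first sum. *)
Definition integralG (f : gpoint G -> R) : \bar R :=
  (signed_sum (fun x : vertex G => (muV W x * f (Vertex x))%:E) +
   signed_sum (fun e : edge G =>
     \int[lebesgue_measure]_(s in `]0%R, elen e[) (restr f e s)%:E))%E.

Definition integrableG (f : gpoint G -> R) : Prop :=
  [/\ summable [set: vertex G] (fun x => (muV W x * f (Vertex x))%:E),
      forall e : edge G,
        lebesgue_measure.-integrable `]0, elen e[ (EFin \o restr f e) &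
      (\esum_(e in [set: edge G])
        \int[lebesgue_measure]_(s in `]0%R, elen e[) `|(restr f e s)%:E|
        < +oo)%E].

Definition time_integral (F : R -> \bar R) : \bar R :=
  \int[lebesgue_measure]_(t in `[0%R, +oo[) F t.

Definition integral_GT (f : gpoint G -> R -> R) : \bar R :=
  time_integral (fun t => integralG (f^~ t)).

Definition integrable_GT (f : gpoint G -> R -> R) : Prop :=
  {ae lebesgue_measure, forall t : R, 0 <= t -> integrableG (f^~ t)} /\
  lebesgue_measure.-integrable `[0, +oo[ (fun t => integralG (f^~ t)).

Definition time_deriv (phi : gpoint G -> R -> R) (p : gpoint G) (t : R) : R :=
  deriv_in `[0, +oo[ (phi p) t.

(* Functions on G x [0, oo) are functions of (p, t) whose values for t < 0 are
   irrelevant. Measurability in space and boundedness make the four integrals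
   in very_weak_solution meaningful for locally integrable data; without
   them no regularity in space would be imposed on phi at all. *)
Record test_function (phi : gpoint G -> R -> R) : Prop := TestFunction {
  test_ge0 : forall p t, 0 <= t -> 0 <= phi p t ;
  test_supp : exists A : set (gpoint G), exists2 T : R, 0 < T &
    compact A /\
    closure [set z : gpoint G * R | 0 <= z.2 /\ phi z.1 z.2 != 0]
      `<=` A `*` `[0, T] ;
  test_C1 : forall p, C1_in `[0, +oo[ (phi p) ;
  test_meas : forall e t, 0 <= t ->
    measurable_fun `]0, elen e[ (fun s => phi (epoint e s) t) ;
  test_bnd : exists M : R, forall p t, 0 <= t ->
    phi p t <= M /\ `|time_deriv phi p t| <= M
}.

(* The inequality of vws_ineq includes the convergence of its integrals. *)
Record very_weak_solution (h : gpoint G -> R -> R) (sigma : R)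
    (u0 : gpoint G -> R) (u : gpoint G -> R -> R) : Prop := VeryWeakSolution {
  vws_L1loc : forall (p : gpoint G) (T : R), 0 < T ->
    lebesgue_measure.-integrable `[0, T] (EFin \o u p) ;
  vws_Lsigmaloc : forall (p : gpoint G) (T : R), 0 < T ->
    lebesgue_measure.-integrable `[0, T]
      (fun t => (h p t * `|u p t| `^ sigma)%:E) ;
  vws_regular : forall t, 0 <= t -> domD (u^~ t) ;
  vws_kirchhoff : forall t, 0 <= t -> forall x : vertex G,
    kirchhoff (u^~ t) x = 0 ;
  vws_ineq : forall phi, test_function phi ->
    let diffusion p t := phi p t * laplacian (u^~ t) p in
    let reaction p t := h p t * `|u p t| `^ sigma * phi p t in
    let transport p t := u p t * time_deriv phi p t in
    let initial p := u0 p * phi p 0 in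
    [/\ integrable_GT diffusion, integrable_GT reaction,
        integrable_GT transport, integrableG initial &
        (integral_GT diffusion + integral_GT reaction +
         integral_GT transport + integralG initial <= 0)%E]
}.

Definition annulus (x0 : vertex G) (theta1 theta2 r : R)
  : set (gpoint G * R) :=
  [set z | 0 <= z.2 /\
    r `^ theta1 <= gdist z.1 (Vertex x0) `^ theta1 + z.2 `^ theta2
      <= 2 * r `^ theta1].

(* Joint measurability of h on each closed edge times [0, oo). *)
Definition edge_measurable (h : gpoint G -> R -> R) : Prop :=
  forall e : edge G,
    measurable_fun (`[0, elen e] `*` `[0, +oo[ : set (R * R))
      (fun z : R * R => h (epoint e z.1) z.2).

End Analysis.

(* Main.v *)
Require Import Defs.
From mathcomp Require Import all_boot all_order all_algebra.
From mathcomp Require Import all_classical all_reals all_analysis.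
From mathcomp Require Import measurable_realfun.
From mathcomp Require Import ring lra.

(** Test functions need only be measurable in space, so the weak inequality can
    be tested separately on the vertices and on each open edge, and the theorem
    splits into a problem on a weighted discrete graph and a problem on each
    edge, joined by the Kirchhoff condition.

    Vertices.  The test function at scale R is ramp(t) (A(x) b(t))^m, carried by
    the vertices.  Here A is a Lipschitz cutoff at distance of order R from x0,
    b is a cutoff at time of order R^(theta1 / theta2), the exponent m is at
    least sigma / (sigma - 1), and ramp increases from 0 at t = 0, which removes
    the initial datum.  Green's formula moves the Laplacian to the cutoff
    (green_formula, cutoff_laplacian_ge); by convexity of the m-th power the
    diffusion and transport terms lose at most u ramp (A b)^(m - 1) times a
    multiple of 1 / R, and only where the cutoff is in transition, a zone covered
    by a fixed number of annuli E_r with r comparable to R (transition_cover).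
    Young's inequality (absorption_pointwise) bounds this loss by lam times the
    reaction term on the zone plus lam^(- 1 / (sigma - 1)) times a power of h
    whose integral the hypothesis controls, uniformly in R
    (dyadic_weight_integral).  The cutoff of scale R / 3 vanishes on the zone of
    scale R, so the reaction integrals I_n at the scales R = 3^n rho satisfy
    I_(n+1) <= lam (I_(n+1) - I_n) + K lam^(- 1 / (sigma - 1)) for every lam > 0.
    Taking lam = 1 bounds them, and lam large then makes them vanish
    (absorption_sequence, absorption_scheme).  Hence u = 0 at all vertices at
    almost every time (vertex_vanishing).

    Edges.  At such a time u >= 0 vanishes at the ends of every edge, so its
    normal derivatives at a vertex all have the same sign; their sum is 0, so
    each is 0 (kirchhoff_endpoint_derivs), and the integral of u'' over each edge
    is 0 (integral_second_derivative).  Testing with a cutoff in time on one open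
    edge therefore leaves no diffusion term, and the same absorption argument
    gives u = 0 on that edge at almost every time (edge_vanishing).  There are
    countably many edges, so the exceptional times form a null set. *)

Import Order.TTheory GRing.Theory Num.Theory.
Import numFieldNormedType.Exports.

Local Open Scope classical_set_scope.
Local Open Scope ring_scope.

Set Implicit Arguments.
Unset Strict Implicit.
Unset Printing Implicit Defensive.

(** * Two elementary inequalities behind the absorption of error terms *)

(** Young's inequality, weighted by powers of a cutoff z in [0, 1].  If the
    first term on the right does not already dominate, X ^ (sigma - 1) is at
    most c / (lam a z), and inserting this bound for X produces the second
    term; the power of z left over is nonnegative as soon as m + 1 is at least
    the conjugate exponent sigma / (sigma - 1). *)
Lemma absorption_pointwise (R : realType) (sigma lam c X a z : R) (m : nat) :
  1 < sigma -> 0 < lam -> 0 <= c -> 0 <= X -> 0 < a -> 0 <= z <= 1 ->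
  sigma / (sigma - 1) <= m.+1%:R ->
  X * c * z ^+ m <= lam * (a * X `^ sigma * z ^+ m.+1) +
    lam `^ (- (sigma - 1)^-1) * c `^ (sigma / (sigma - 1)) *
    a `^ (- (sigma - 1)^-1).
Proof.
move=> s1 l0 c0 X0 a0 /andP[z0 z1] qm.
set p := (sigma - 1)^-1.
have s10 : 0 < sigma - 1 by rewrite subr_gt0.
have p0 : 0 < p by rewrite invr_gt0.
have qE : sigma / (sigma - 1) = 1 + p.
  by rewrite /p -[X in X / _](subrK 1) mulrDl mul1r divff// gt_eqF.
rewrite qE in qm *.
have [le1|lt1] := leP (X * c * z ^+ m) (lam * (a * X `^ sigma * z ^+ m.+1)).
  by apply: (le_trans le1); rewrite lerDl !mulr_ge0// powR_ge0.
have {}lt0 : 0 < X * c * z ^+ m.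
  apply: le_lt_trans lt1; rewrite !mulr_ge0 ?powR_ge0 ?exprn_ge0//; exact: ltW.
have X1 : 0 < X.
  rewrite lt_neqAle X0 andbT eq_sym; apply: contraTneq lt0 => ->.
  by rewrite !mul0r ltxx.
have c1 : 0 < c.
  rewrite lt_neqAle c0 andbT eq_sym; apply: contraTneq lt0 => ->.
  by rewrite mulr0 mul0r ltxx.
have zm0 : 0 < z ^+ m by move: lt0; rewrite pmulr_rgt0// mulr_gt0.
have q0 : 1 + p != 0 by rewrite gt_eqF// addr_gt0.
rewrite -[leLHS]add0r lerD//.
  by rewrite !mulr_ge0 ?powR_ge0 ?exprn_ge0//; exact: ltW.
case: (eqVneq z 0) => [z00|zn0].
  (* z ^+ m > 0 leaves only m = 0, which contradicts 1 < 1 + p <= m + 1. *)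
  move: zm0 qm; rewrite z00; case: (m) => [|m']; last by rewrite expr0n/= ltxx.
  by move=> _; rewrite gerDl leNgt p0.
have z2 : 0 < z by rewrite lt_neqAle eq_sym zn0.
have XE : X `^ sigma = X * X `^ (sigma - 1).
  rewrite -{2}(powRr1 X0) -powRD; first by rewrite subrKC.
  by apply/implyP => _; rewrite gt_eqF.
have X2 : lam * a * z * X `^ (sigma - 1) < c.
  rewrite -(ltr_pM2l (mulr_gt0 X1 zm0)); move: lt1; rewrite XE exprS.
  congr (_ < _); ring.
have X3 : X <= c `^ p * lam `^ (- p) * a `^ (- p) * z `^ (- p).
  rewrite !powRN !ler_pdivlMr ?powR_gt0//.
  rewrite -!mulrA -[X in _ <= X]powRr1 ?powR_ge0//.
  have -> : X * (z `^ p * (a `^ p * lam `^ p)) =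
            (lam * a * z * X `^ (sigma - 1)) `^ p.
    rewrite !powRM ?mulr_ge0 ?powR_ge0//; try exact: ltW.
    rewrite -[(X `^ _) `^ p]powRrM divff ?gt_eqF// powRr1//; ring.
  rewrite powRr1 ?powR_ge0//; apply: ge0_ler_powR; rewrite ?nnegrE//; try exact: ltW.
  by rewrite !mulr_ge0 ?powR_ge0//; exact: ltW.
have z3 : z ^+ m * z `^ (- p) <= 1.
  rewrite -powR_mulrn// -powRD; last by apply/implyP; rewrite zn0.
  rewrite -[leRHS](powRr0 z); apply: ger_powR; first by rewrite z2.
  by move: qm; rewrite -natr1 [_ + p]addrC lerD2r subr_ge0.
rewrite powRD; last by rewrite (negbTE q0).
rewrite powRr1//.
apply: (@le_trans _ _
  ((c `^ p * lam `^ (- p) * a `^ (- p) * c) * (z ^+ m * z `^ (- p)))).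
  have -> : c `^ p * lam `^ (- p) * a `^ (- p) * c * (z ^+ m * z `^ (- p)) =
    (c `^ p * lam `^ (- p) * a `^ (- p) * z `^ (- p)) * (c * z ^+ m) by ring.
  by rewrite -mulrA ler_wpM2r// mulr_ge0// ltW.
apply: (le_trans (ler_wpM2l _ z3)); first by rewrite !mulr_ge0 ?powR_ge0.
by rewrite mulr1 le_eqVlt; apply/orP; left; apply/eqP; ring.
Qed.

(** With lam = 1 the inequality bounds the sequence by K.  A positive value
    would then force, for lam so large that K lam ^ (- p) is half of it,
    increments bounded below, and the sequence could not stay bounded. *)
Lemma absorption_sequence (R : realType) (K p : R) (i : nat -> R) :
  0 < p -> 0 <= K -> (forall k, 0 <= i k) -> (forall k, i k <= i k.+1) ->
  (forall lam k, 0 < lam ->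
    i k.+1 <= lam * (i k.+1 - i k) + K * lam `^ (- p)) ->
  forall k, i k = 0.
Proof.
move=> p0 K0 i0 nd ineq k0; apply/eqP; rewrite eq_le i0 andbT leNgt.
apply/negP => ik0.
have bnd k : i k <= K.
  by have := ineq 1 k ltr01; rewrite powR1 mul1r mulr1; lra.
pose d := i k0 / 2; have d0 : 0 < d by rewrite divr_gt0.
(* This lam solves (K + 1) * lam `^ (- p) = d. *)
pose lam := ((K + 1) / d) `^ p^-1.
have K1 : 0 < K + 1 by lra.
have Kd : 0 < (K + 1) / d by rewrite divr_gt0.
have lam0 : 0 < lam by rewrite powR_gt0.
have lamE : K * lam `^ (- p) <= d.
  rewrite powRN /lam -powRrM mulVf ?gt_eqF// powRr1 ?(ltW Kd)//.
  by rewrite invf_div mulrA ler_pdivrMr// mulrC ler_pM2l//; lra.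
have mono n : i k0 <= i (k0 + n)%N.
  by elim: n => [|n IH]; rewrite ?addn0// addnS (le_trans IH).
have grow n : n%:R * (d / lam) <= i (k0 + n)%N.
  elim: n => [|n IH]; first by rewrite mul0r.
  have := ineq lam (k0 + n)%N lam0; have := mono n.+1; rewrite addnS => h1 h2.
  have h3 : d <= lam * (i (k0 + n).+1 - i (k0 + n)%N).
    by rewrite /d in lamE *; lra.
  rewrite -[n.+1]addn1 natrD mulrDl mul1r.
  move: h3; rewrite mulrC -ler_pdivrMr// => h3; lra.
have [n nK] : exists n : nat, K / (d / lam) < n%:R.
  exists (Num.bound (K / (d / lam))); apply: archi_boundP.
  by rewrite divr_ge0// ltW// divr_gt0.
have := grow n; have := bnd (k0 + n)%N.
by move: nK; rewrite ltr_pdivrMr ?divr_gt0//; lra.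
Qed.

Lemma exprB_le_tangent (R : realDomainType) (a b : R) (m : nat) :
  0 <= a -> 0 <= b ->
  a ^+ m.+1 - b ^+ m.+1 <= m.+1%:R * a ^+ m * (a - b).
Proof.
move=> a0 b0; elim: m => [|m IH]; first by rewrite !expr1 expr0 mulr1 mul1r.
have -> : a ^+ m.+2 - b ^+ m.+2 =
    a * (a ^+ m.+1 - b ^+ m.+1) + b ^+ m.+1 * (a - b).
  by rewrite [a ^+ m.+2]exprS [b ^+ m.+2]exprS; ring.
have h1 : b ^+ m.+1 * (a - b) <= a ^+ m.+1 * (a - b).
  have [ab|/ltW ba] := leP a b.
    by rewrite ler_wnM2r ?subr_le0// lerXn2r ?nnegrE.
  by rewrite ler_wpM2r ?subr_ge0// lerXn2r ?nnegrE.
have h2 := ler_wpM2l a0 IH.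
apply: (le_trans (lerD h2 h1)).
rewrite le_eqVlt; apply/orP; left; apply/eqP.
by rewrite -[m.+2]addn1 natrD [a ^+ m.+1]exprS; ring.
Qed.

(** * Cutoffs in time *)

Lemma cvg_diff_quotient (R : realType) (f : R -> R) (s l : R) :
  is_derive s 1 f l -> (f y - f s) / (y - s) @[y --> s^'] --> l.
Proof.
move=> [df <-].
have sh : (y - s) @[y --> s^'] --> (0 : R)^'.
  move=> P [e /= e0 eP]; exists e => //= y /= sy ys; apply: eP => /=.
    by rewrite sub0r normrN distrC.
  by rewrite subr_eq0.
have := cvg_comp _ _ sh df; apply: cvg_trans; apply: near_eq_cvg.
near=> y => /=.
by rewrite /comp/= [_%:A]mulr1 subrK mulrC.
Unshelve. all: by end_near. Qed.

Lemma properfilter_within_ray (R : realType) (s : R) : 0 <= s ->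
  ProperFilter (within `[0, +oo[ s^').
Proof.
move=> s0; apply: Build_ProperFilter_ex => P [e /= e0 eP].
exists (s + e / 2); apply: eP => /=.
- rewrite opprD addNKr normrN gtr0_norm ?divr_gt0//.
  by rewrite ltr_pdivrMr// ltr_pMr// ltr1n.
- by rewrite gt_eqF// ltrDl divr_gt0.
- by rewrite in_itv/= andbT addr_ge0// divr_ge0// (ltW e0).
Qed.

Lemma cvg_deriv_in (R : realType) (D : set R) (f : R -> R) (s l : R) :
  is_derive s 1 f l ->
  (f y - f s) / (y - s) @[y --> within D s^'] --> l.
Proof.
move=> /cvg_diff_quotient; apply: cvg_trans; apply: cvg_app; exact: cvg_within.
Qed.

Lemma deriv_in_ray (R : realType) (f : R -> R) (s l : R) : 0 <= s ->
  is_derive s 1 f l -> deriv_in `[0, +oo[ f s = l.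
Proof.
move=> s0 df; have PF := properfilter_within_ray s0.
by apply: cvg_lim => //; exact: cvg_deriv_in.
Qed.

Lemma C1_in_ray (R : realType) (f df : R -> R) :
  (forall s : R, is_derive s 1 f (df s)) -> continuous df ->
  C1_in `[0, +oo[ f.
Proof.
move=> fd cdf; split=> [s s0|].
  by apply/cvg_ex; exists (df s); exact: cvg_deriv_in.
apply: (@subspace_eq_continuous _ _ _ df).
  move=> s; rewrite inE /= in_itv/= andbT => s0.
  by rewrite -(deriv_in_ray s0 (fd s)).
exact: continuous_subspaceT.
Qed.

(** The square keeps the positive part of class C1; every cutoff in time is
    built from it. *)
Definition sqpos (R : realType) (s : R) : R := (Num.max 0 s) ^+ 2.

Lemma sqpos_ge0 (R : realType) (s : R) : 0 <= sqpos s.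
Proof. exact: sqr_ge0. Qed.

Lemma sqpos_taylor (R : realType) (s h : R) :
  `|2 * Num.max 0 s * h - (sqpos (h + s) - sqpos s)| <= h ^+ 2.
Proof.
rewrite /sqpos ler_norml.
have [s0|s0] := leP 0 s; have [hs|hs] := leP 0 (h + s); apply/andP; split; nra.
Qed.

(** The Taylor remainder is at most quadratic, uniformly over the three sign
    patterns of s and h + s. *)
Lemma is_derive_sqpos (R : realType) (s : R) :
  is_derive s 1 (@sqpos R) (2 * Num.max 0 s).
Proof.
have C : h^-1 *: (sqpos (h *: 1 + s) - sqpos s) @[h --> (0:R)^'] -->
    2 * Num.max 0 s.
  apply/cvgrPdist_le => /= e e0; near=> h.
  have h0 : h != 0 by near: h; exact: nbhs_dnbhs_neq.
  have he : `|h| <= e.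
    near: h; apply: nbhs_dnbhs; exists e => //= y /=.
    by rewrite sub0r normrN => /ltW.
  rewrite [h%:A]mulr1; apply: le_trans he.
  have -> : 2 * Num.max 0 s - h^-1 *: (sqpos (h + s) - sqpos s) =
      h^-1 * (2 * Num.max 0 s * h - (sqpos (h + s) - sqpos s)).
    by rewrite mulrBr [h^-1 * _]mulrC mulfK// .
  rewrite normrM normfV ler_pdivrMl ?normr_gt0// -normrM -expr2.
  by rewrite [leRHS]ger0_norm ?sqr_ge0//; exact: sqpos_taylor.
have D : derivable (@sqpos R) s 1 by apply/cvg_ex; eexists; exact: C.
by apply: DeriveDef => //; apply: cvg_lim.
Unshelve. all: by end_near. Qed.

(** A nondecreasing factor that vanishes at t = 0 and is positive afterwards:
    it removes the initial datum from the weak inequality, and its own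
    derivative only contributes a term of favourable sign. *)
Definition ramp (R : realType) (t : R) : R := 1 - sqpos (1 - t).

(** The quadratic profile, rather than an affine one, makes the derivative
    vanish at t = T, so that even powers of the plateau are of class C1. *)
Definition plateau (R : realType) (T t : R) : R :=
  Num.max 0 (1 - sqpos (t / T - 1)).

Definition time_cutoff (R : realType) (T : R) (k : nat) (t : R) : R :=
  ramp t * plateau T t ^+ k.+1.*2.

(** The derivative of time_cutoff. *)
Definition time_cutoff' (R : realType) (T : R) (k : nat) (t : R) : R :=
  2 * Num.max 0 (1 - t) * plateau T t ^+ k.+1.*2 -
  ramp t * (4 * k.+1%:R / T * plateau T t ^+ k.*2.+1 * Num.max 0 (t / T - 1)).

Lemma is_derive_time_cutoff (R : realType) (T : R) (k : nat) (t : R) :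
  is_derive t 1 (time_cutoff T k) (time_cutoff' T k t).
Proof.
have expfct (f : R -> R) n y : (f ^+ n) y = f y ^+ n.
  by elim: n => [|n IH]; rewrite ?expr0// !exprS -IH.
have -> : time_cutoff T k =
    (fun t => 1 - sqpos (1 - t)) *
    (fun t => sqpos (1 - sqpos (t / T - 1))) ^+ k.+1.
  apply/funext => y; rewrite /time_cutoff -muln2 mulnC exprM.
  pose b (t : R) := sqpos (1 - sqpos (t / T - 1)).
  by rewrite -[plateau T y ^+ 2]/(b y) -expfct.
have d1 : is_derive t 1 (fun t => 1 - sqpos (1 - t)) (2 * Num.max 0 (1 - t)).
  have h1 : is_derive t 1 (fun t : R => 1 - t) (-1).
    by apply: is_derive_eq; rewrite add0r mul1r.
  have h2 := @is_derive1_comp _ (@sqpos R) (fun t => 1 - t) t _ _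
    (is_derive_sqpos _) h1.
  by apply: is_derive_eq; ring.
have d2 : is_derive t 1 (fun t : R => t / T - 1) (T^-1).
  by apply: is_derive_eq; rewrite scaler0 subr0 add0r [_%:A]mulr1.
have d3 := @is_derive1_comp _ (@sqpos R) _ t _ _ (is_derive_sqpos _) d2.
have d4 : is_derive t 1 (fun t : R => 1 - sqpos (t / T - 1))
    (- (2 * Num.max 0 (t / T - 1) * T^-1)).
  by apply: is_derive_eq; rewrite add0r mul1r.
have d5 := @is_derive1_comp _ (@sqpos R) _ t _ _ (is_derive_sqpos _) d4.
apply: is_derive_eq; rewrite expfct /=.
have sqE n : plateau T t ^+ n.*2 = sqpos (1 - sqpos (t / T - 1)) ^+ n.
  by rewrite -muln2 mulnC exprM.
rewrite /time_cutoff' [plateau T t ^+ k.*2.+1]exprS !sqE exprS.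
rewrite -[Num.max 0 (1 - sqpos _)]/(plateau T t) -[1 - sqpos (1 - t)]/(ramp t).
rewrite -![_ *: _]/(_ * _) /=; ring.
Qed.

Lemma continuous_time_cutoff' (R : realType) (T : R) (k : nat) :
  continuous (time_cutoff' T k).
Proof.
have cmax (f : R -> R) : continuous f -> continuous (fun s => Num.max 0 (f s)).
  by move=> cf s; apply: continuous_max; [exact: cst_continuous|exact: cf].
have cexp (f : R -> R) n : continuous f -> continuous (fun s => f s ^+ n).
  move=> cf s; apply: (@continuous_comp _ _ _ f (fun y : R => y ^+ n)).
    exact: cf.
  exact: exprn_continuous.
have csub (f : R -> R) c : continuous f -> continuous (fun s => c - f s).
  by move=> cf s; apply: cvgB; [exact: cst_continuous|exact: cf].
have cmul (f g : R -> R) : continuous f -> continuous g ->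
    continuous (fun s => f s * g s).
  by move=> cf cg s; apply: continuousM; [exact: cf|exact: cg].
have ccst (c : R) : continuous (fun _ : R => c) by exact: cst_continuous.
have cid : continuous (fun s : R => s) by move=> s.
have c1 : continuous (fun s : R => s / T - 1).
  move=> s; apply: cvgB; last exact: cst_continuous.
  exact: (cmul _ _ cid (ccst _)).
have cb : continuous (plateau T) by apply/cmax/csub/cexp/cmax.
have cA : continuous
    (fun t : R => 2 * Num.max 0 (1 - t) * plateau T t ^+ k.+1.*2).
  by apply: (cmul _ _); [apply: (cmul _ _) => //; apply/cmax/csub|exact: cexp].
have cB : continuous (fun t : R => ramp t *
    (4 * k.+1%:R / T * plateau T t ^+ k.*2.+1 * Num.max 0 (t / T - 1))).
  apply: (cmul _ _); first exact/csub/cexp/cmax/csub.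
  by apply: (cmul _ _); [apply: (cmul _ _) => //; exact: cexp|exact: cmax].
by move=> s; apply: cvgB; [exact: cA|exact: cB].
Qed.

Lemma ramp0 (R : realType) : ramp (0 : R) = 0.
Proof. by rewrite /ramp /sqpos subr0 max_r// expr1n subrr. Qed.

Lemma ramp_ge0 (R : realType) (t : R) : 0 <= t -> 0 <= ramp t.
Proof.
by move=> t0; rewrite /ramp /sqpos; have [?|?] := leP 0 (1 - t); nra.
Qed.

Lemma ramp_le1 (R : realType) (t : R) : ramp t <= 1.
Proof. by rewrite /ramp gerBl sqpos_ge0. Qed.

Lemma ramp_gt0 (R : realType) (t : R) : 0 < t -> 0 < ramp t.
Proof.
by move=> t0; rewrite /ramp /sqpos; have [?|?] := leP 0 (1 - t); nra.
Qed.

Lemma plateau_ge0 (R : realType) (T t : R) : 0 <= plateau T t.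
Proof. by rewrite /plateau le_max lexx. Qed.

Lemma plateauX_ge0 (R : realType) (T t : R) (n : nat) : 0 <= plateau T t ^+ n.
Proof. by rewrite exprn_ge0// plateau_ge0. Qed.

Lemma plateau_le1 (R : realType) (T t : R) : plateau T t <= 1.
Proof. by rewrite /plateau ge_max ler01 gerBl sqpos_ge0. Qed.

Lemma plateau_eq1 (R : realType) (T t : R) : 0 < T -> t <= T -> plateau T t = 1.
Proof.
move=> T0 tT; rewrite /plateau /sqpos [Num.max 0 (_ / _ - 1)]max_l.
  by rewrite expr0n subr0 max_r.
by rewrite subr_le0 ler_pdivrMr// mul1r.
Qed.

Lemma plateau_eq0 (R : realType) (T t : R) : 0 < T -> 2 * T <= t ->
  plateau T t = 0.
Proof.
move=> T0 tT; apply: max_l; rewrite subr_le0 /sqpos.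
have h : 2 <= t / T by rewrite ler_pdivlMr.
by rewrite max_r; [rewrite -[leLHS](expr1n _ 2) lerXn2r ?nnegrE//; lra|lra].
Qed.

Lemma plateau_homo (R : realType) (T1 T2 t : R) : 0 <= t -> 0 < T1 -> T1 <= T2 ->
  plateau T1 t <= plateau T2 t.
Proof.
move=> t0 T0 T12.
rewrite /plateau ge_max le_max lexx/= le_max; apply/orP; right.
rewrite lerD2l lerN2 /sqpos.
apply: lerXn2r; [by rewrite nnegrE le_max lexx|by rewrite nnegrE le_max lexx|].
rewrite ge_max le_max lexx/= le_max; apply/orP; right.
by rewrite lerD2r ler_wpM2l// lef_pV2// posrE// (lt_le_trans T0).
Qed.

(** The decrease of the cutoff happens only after time T, at rate 1 / T, and
    costs one power of the plateau; the increase of the ramp is discarded. *)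
Lemma time_cutoff'_ge (R : realType) (T : R) (k : nat) (t : R) :
  0 <= t -> 0 < T ->
  - time_cutoff' T k t <=
    ramp t * plateau T t ^+ k.*2.+1 * (4 * k.+1%:R / T) * (T <= t)%R%:R.
Proof.
move=> t0 T0; rewrite /time_cutoff' opprB lerBlDr -[leLHS]addr0 lerD//; last first.
  by rewrite mulr_ge0 ?plateauX_ge0// mulr_ge0// le_max lexx.
have k0 : 0 <= 4 * k.+1%:R / T by rewrite divr_ge0// ltW.
have [Tt|tT] := leP T t; last first.
  by rewrite max_l ?mulr0 ?mulr0// subr_le0 ler_pdivrMr// mul1r ltW.
rewrite mulr1 -[leRHS]mulrA ler_wpM2l ?ramp_ge0//.
have [b0|b0] := leP (t / T - 1) 0.
  by rewrite mulr0 mulr_ge0// plateauX_ge0.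
have [b2|b2] := leP 2 (t / T).
  have p0 : plateau T t = 0 by rewrite plateau_eq0 -?ler_pdivlMr.
  by rewrite p0 exprS !(mul0r,mulr0).
rewrite [X in X * _ <= _]mulrC ler_piMr//; last lra.
by rewrite mulr_ge0// plateauX_ge0.
Qed.

Lemma time_cutoff_ge0 (R : realType) (T : R) (k : nat) (t : R) :
  0 <= t -> 0 <= time_cutoff T k t.
Proof. by move=> t0; rewrite mulr_ge0 ?ramp_ge0 ?plateauX_ge0. Qed.

Lemma time_cutoff_homo (R : realType) (T1 T2 : R) (k : nat) (t : R) :
  0 <= t -> 0 < T1 -> T1 <= T2 -> time_cutoff T1 k t <= time_cutoff T2 k t.
Proof.
move=> t0 T10 T12; rewrite ler_wpM2l ?ramp_ge0//.
by apply: lerXn2r; rewrite ?nnegrE ?plateau_ge0//; exact: plateau_homo.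
Qed.

Lemma time_cutoff_eq_ramp (R : realType) (T : R) (k : nat) (t : R) :
  0 < T -> t <= T -> time_cutoff T k t = ramp t.
Proof. by move=> T0 tT; rewrite /time_cutoff plateau_eq1// expr1n mulr1. Qed.

Lemma time_cutoff0 (R : realType) (T : R) (k : nat) : time_cutoff T k 0 = 0.
Proof. by rewrite /time_cutoff ramp0 mul0r. Qed.

Lemma time_cutoff'_bounded (R : realType) (T : R) (k : nat) (t : R) :
  0 <= t -> 0 < T -> `|time_cutoff' T k t| <= 2 + 4 * k.+1%:R / T.
Proof.
move=> t0 T0.
have k0 : 0 <= 4 * k.+1%:R / T by rewrite divr_ge0// ltW.
have p0 n := plateauX_ge0 T t n.
have p1 n : plateau T t ^+ n <= 1.
  by rewrite exprn_ile1 ?plateau_ge0 ?plateau_le1.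
rewrite ler_norml; apply/andP; split.
  rewrite lerNl; apply: (le_trans (time_cutoff'_ge k t0 T0)).
  apply: (@le_trans _ _ (4 * k.+1%:R / T)); last by rewrite lerDr.
  have r0 := ramp_ge0 t0; have r1 := ramp_le1 t.
  rewrite -[leRHS]mulr1 ler_pM//; first by rewrite mulr_ge0// mulr_ge0.
    by rewrite ler_piMl// mulr_ile1.
  by case: (T <= t).
apply: (@le_trans _ _ 2); last by rewrite lerDl.
rewrite /time_cutoff' -[leRHS]subr0 lerB//; last first.
  by rewrite mulr_ge0 ?ramp_ge0// mulr_ge0 ?le_max ?lexx// mulr_ge0.
rewrite -[leRHS]mulr1 -mulrA ler_wpM2l// mulr_ile1// ?le_max ?lexx//.
by rewrite ge_max ler01 gerBl.
Qed.

(** * The path metric *)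

Section PathMetric.
Context {R : realType} {G : metricGraph R}.
Implicit Types (p q o : gpoint G) (e : edge G).

Lemma gpath_ge0 p q L : gpath p q L -> 0 <= L.
Proof. by elim=> // e s t q' K _ _ _ K0; rewrite addr_ge0. Qed.

Lemma gdist_ge0 p q : gconnected G -> 0 <= gdist p q.
Proof.
move=> cG; apply: lb_le_inf; first exact: cG.
by move=> L; exact: gpath_ge0.
Qed.

Lemma gdist_le_gpath p q o L : gconnected G -> gpath p q L ->
  gdist p o <= L + gdist q o.
Proof.
move=> cG pq; rewrite -lerBlDl; apply: lb_le_inf; first exact: cG.
move=> K qo; rewrite lerBlDl; apply: ge_inf; last exact: gpath_cat pq qo.
by exists 0 => ?; exact: gpath_ge0.
Qed.

Lemma gdist_lipschitz p q o L : gconnected G -> gpath p q L ->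
  `|gdist p o - gdist q o| <= L.
Proof.
move=> cG pq; rewrite ler_distl; apply/andP; split.
  by rewrite lerBlDl; exact: gdist_le_gpath (gpath_sym pq).
by rewrite addrC; exact: gdist_le_gpath.
Qed.

Lemma epoint0 e : epoint e 0 = Vertex (ini e).
Proof. by rewrite /epoint insubF ?ltxx// lexx. Qed.

Lemma epoint_elen e : epoint e (elen e) = Vertex (ter e).
Proof. by rewrite /epoint insubF ?ltxx ?andbF// leNgt elen_gt0. Qed.

Lemma epoint_val e (s : {s : R | 0 < s < elen e}) :
  epoint e (val s) = Inner e s.
Proof. by rewrite /epoint valK. Qed.

Lemma epoint_inner e (s : R) (s01 : 0 < s < elen e) :
  epoint e s = Inner e (exist _ s s01).
Proof. by rewrite -epoint_val. Qed.

Lemma epoint_clamp e (s : R) :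
  epoint e s = epoint e (Num.max 0 (Num.min s (elen e))).
Proof.
have l0 := elen_gt0 e.
have [sl|ls] := leP s (elen e); have [s0|s0] := leP 0 s => //.
- by rewrite epoint0 /epoint insubF ?(ltW s0)// ltNge (ltW s0).
- rewrite max_r ?(ltW l0)// epoint_elen /epoint insubF.
    by rewrite leNgt (lt_trans l0).
  by rewrite [s < _]ltNge (ltW ls) andbF.
- by move: (lt_trans s0 (lt_trans l0 ls)); rewrite ltxx.
Qed.

(** The parametrization of an edge clamps its argument to the edge, and the
    clamp is 1-Lipschitz. *)
Lemma epoint_lipschitz e (s t : R) :
  exists2 L, gpath (epoint e s) (epoint e t) L & L <= `|s - t|.
Proof.
have l0 := elen_gt0 e.
pose c (s : R) := Num.max 0 (Num.min s (elen e)).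
have c01 x : 0 <= c x <= elen e.
  by rewrite /c le_max lexx ge_max (ltW l0) ge_min lexx orbT.
exists (`|c s - c t| + 0).
  rewrite [X in gpath X _ _]epoint_clamp [X in gpath _ X _]epoint_clamp.
  by apply: gpathS; [exact: c01|exact: c01|exact: gpath0].
rewrite addr0 ler_norml; have : s - t <= `|s - t| by rewrite ler_norm.
have : t - s <= `|s - t| by rewrite distrC ler_norm.
have := normr_ge0 (s - t); rewrite /c.
by have [?|?] := leP s (elen e); have [?|?] := leP t (elen e);
  rewrite ?(max_r (ltW l0)) => ? ? ?; apply/andP;
  have [?|?] := leP 0 s; have [?|?] := leP 0 t; split; lra.
Qed.

Lemma continuous_gdist o : gconnected G -> continuous (fun p => gdist p o : R).
Proof.
move=> cG p; apply/(@cvgrPdist_lt _ R _ (nbhs p) (nbhs_filter p)) => e e0.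
near=> q; have [L pq Le] : ball p e q by near: q; exact: nbhsx_ballx.
exact: le_lt_trans (gdist_lipschitz o cG pq) Le.
Unshelve. all: by end_near. Qed.

Lemma continuous_epoint e : continuous (epoint e : R -> gpoint G).
Proof.
move=> s; apply/cvg_ballP => r r0; near=> t.
have [L st Ls] := epoint_lipschitz e s t.
exists L => //; apply: (le_lt_trans Ls); near: t.
exact: (nbhsx_ballx s r r0).
Unshelve. all: by end_near. Qed.

Lemma adj_gpath (x y : vertex G) : adj x y ->
  exists e, gpath (Vertex x) (Vertex y) (elen e).
Proof.
have P e : gpath (Vertex (ini e)) (Vertex (ter e)) (elen e).
  rewrite -epoint0 -epoint_elen; have l0 := ltW (elen_gt0 e).
  have lE : elen e = `|0 - elen e| + 0 by rewrite sub0r normrN ger0_norm// addr0.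
  rewrite [X in gpath _ _ X]lE.
  by apply: gpathS; rewrite ?lexx// ?l0//; exact: gpath0.
by move=> [e [[<- <-]|[<- <-]]]; exists e; [|apply: gpath_sym]; exact: P.
Qed.

(** A closed ball is a closed part of the union of finitely many vertices and
    of finitely many closed edges, each edge being the image of a segment. *)
Lemma compact_closed_ball o (r : R) : gconnected G ->
  (forall r : R, 0 < r -> finitely_many_cells (gball o r)) ->
  compact [set p | gdist p o <= r].
Proof.
move=> cG fin; have r1 : 0 < Num.max r 0 + 1 by rewrite ltr_pwDr// le_max lexx orbT.
have [fV fE] := fin _ r1.
set V := [set x | _] in fV; set E := [set e | _] in fE.
have inb p : gdist p o <= r -> gball o (Num.max r 0 + 1) p.
  move=> pr; rewrite /gball/= (le_lt_trans pr)// ltr_pwDr// le_max lexx//.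
apply: (@subclosed_compact _ _
    (Vertex @` V `|` \bigcup_(e in E) (epoint e @` `[0, elen e]%classic))).
- have /continuous_closedP/(_ _ (@closed_le _ r)) := @continuous_gdist o cG.
  exact.
- apply: compactU; first by apply: finite_compact; exact: finite_image.
  rewrite -(bigsetU_fset_set _ fE); apply: bigsetU_compact => // e _.
  apply: continuous_compact; last exact: segment_compact.
  exact/continuous_subspaceT/continuous_epoint.
- move=> [x|e s] /inb pb; first by left; exists x.
  right; exists e; first by exists s.
  exists (val s); last exact: epoint_val.
  by case: s {pb} => s /= /andP[s0 s1]; rewrite in_itv/= !ltW.
Qed.

Lemma gpath_vertex_star (x : vertex G) q L : gpath (Vertex x) q L ->
  q = Vertex x \/ exists e, ini e = x \/ ter e = x.
Proof.
move=> xq; inversion xq as [p0 h1 h2|e s t q0 L0 s01 t01 tq h1 h2 h3].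
  by left.
right; exists e; move: h1; rewrite /epoint; case: insubP => //= _.
by case: ifP => _ [->]; [left|right].
Qed.

(** In a connected graph with more than one vertex, every vertex is an end of
    some edge; measurability at a vertex is thus inherited from an edge. *)
Lemma vertex_epoint (x : vertex G) : gconnected G ->
  infinite_set [set: vertex G] ->
  exists e, exists2 s, 0 <= s <= elen e & Vertex x = epoint e s.
Proof.
move=> cG iV.
have [y yx] : exists y : vertex G, y <> x.
  apply: contrapT => /forallNP h; apply: iV.
  by apply: (sub_finite_set _ (finite_set1 x)) => y _; exact: contrapT (h y).
have [L xy] := cG (Vertex x) (Vertex y).
have [[yx']|[e ex]] := gpath_vertex_star xy; first by rewrite yx' in yx.
have l0 := ltW (elen_gt0 e).
exists e; case: ex => <-; [exists 0|exists (elen e)]; rewrite ?lexx ?l0//.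
  by rewrite epoint0.
by rewrite epoint_elen.
Qed.

End PathMetric.

(** * Integrals and test functions carried by few cells *)

Lemma signed_sum_finite (R : realType) (T : choiceType) (S : set T)
    (a : T -> R) : finite_set S -> (forall i, ~ S i -> a i = 0) ->
  signed_sum (fun i => (a i)%:E) = (\sum_(i \in S) a i)%:E.
Proof.
move=> fS a0.
have E (b : T -> R) : (forall i, 0 <= b i) -> (forall i, ~ S i -> b i = 0) ->
    (\esum_(i in [set: T]) (b i)%:E = (\sum_(i \in S) b i)%:E)%E.
  move=> b0 bS;
  have -> : (\esum_(i in [set: T]) (b i)%:E = \esum_(i in S) (b i)%:E)%E.
    rewrite [RHS]esum_mkcond; apply: eq_esum => i _.
    by case: ifPn => // /negP; rewrite inE => /bS ->.
  by rewrite esum_fset -?fsumEFin// => i _; rewrite lee_fin.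
have pE i : ((fun i => (a i)%:E)^\+ i = (Num.max (a i) 0)%:E)%E.
  by rewrite funeposE EFin_max.
have nE i : ((fun i => (a i)%:E)^\- i = (Num.max (- a i) 0)%:E)%E.
  by rewrite funenegE EFin_max.
rewrite /signed_sum (eq_esum (fun i _ => pE i)) (eq_esum (fun i _ => nE i)).
rewrite !E; last 4 first.
- by move=> i; rewrite le_max lexx orbT.
- by move=> i /a0 ->; rewrite oppr0 maxxx.
- by move=> i; rewrite le_max lexx orbT.
- by move=> i /a0 ->; rewrite maxxx.
rewrite -EFinB; congr (_%:E); rewrite !fsbig_finite// -sumrB.
apply: eq_bigr => i _.
have [a1|a1] := leP 0 (a i).
  by rewrite max_r ?subr0// oppr_le0.
by rewrite max_l ?sub0r ?opprK// oppr_ge0 ltW.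
Qed.

Lemma signed_sum0 (R : realType) (T : choiceType) (a : T -> \bar R) :
  (forall i, a i = 0%E) -> signed_sum a = 0%E.
Proof.
move=> a0; rewrite /signed_sum !esum1 ?subee// => i _.
  by rewrite funenegE a0 oppe0 maxxx.
by rewrite funeposE a0 maxxx.
Qed.

Lemma signed_sum1 (R : realType) (T : choiceType) (a : T -> \bar R) (i0 : T) :
  (forall i, i <> i0 -> a i = 0%E) -> signed_sum a = a i0.
Proof.
move=> a0.
have E (b : T -> \bar R) : (forall i, 0 <= b i)%E ->
    (forall i, i <> i0 -> b i = 0%E) -> (\esum_(i in [set: T]) b i = b i0)%E.
  move=> b0 bS.
  rewrite -[RHS](@esum_set1 _ _ i0 b)// [RHS]esum_mkcond; apply: eq_esum => i _.
  by case: ifPn => // /negP; rewrite inE => /bS ->.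
rewrite /signed_sum !E//.
- exact: (esym (congr1 (@^~ i0) (funeposneg a))).
- by move=> i /a0 ai; rewrite funenegE ai oppe0 maxxx.
- by move=> i /a0 ai; rewrite funeposE ai maxxx.
Qed.

Section Supports.
Context {R : realType} {G : metricGraph R} (W : weights G).

Lemma integralG_vertices (S : set (vertex G)) (f : gpoint G -> R) :
  finite_set S -> (forall x, ~ S x -> f (Vertex x) = 0) ->
  (forall e s, f (Inner e s) = 0) ->
  integralG W f = (\sum_(x \in S) muV W x * f (Vertex x))%:E.
Proof.
move=> fS f0 fI; rewrite /integralG (signed_sum_finite fS).
  rewrite signed_sum0 ?adde0// => e; apply: integral0_eq => s /=.
  by rewrite in_itv/= => s01; rewrite /restr (epoint_inner s01) fI.
by move=> x /f0 ->; rewrite mulr0.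
Qed.

Lemma integralG_edge (e0 : edge G) (f : gpoint G -> R) :
  (forall x, f (Vertex x) = 0) ->
  (forall e s, e <> e0 -> f (Inner e s) = 0) ->
  (integralG W f =
    \int[lebesgue_measure]_(s in `]0%R, elen e0[) (restr f e0 s)%:E)%E.
Proof.
move=> f0 fI; rewrite /integralG signed_sum0 ?add0e.
  rewrite (@signed_sum1 _ _ _ e0)// => e ee; apply: integral0_eq => s /=.
  by rewrite in_itv/= => s01; rewrite /restr (epoint_inner s01) fI.
by move=> x; rewrite f0 mulr0.
Qed.

End Supports.

Section TestFunctions.
Context {R : realType} {G : metricGraph R}.
Variables (al : gpoint G -> R) (T : R) (k : nat).

Lemma time_deriv_cutoff (p : gpoint G) (t : R) : 0 <= t ->
  time_deriv (fun p t => al p * time_cutoff T k t) p t =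
  al p * time_cutoff' T k t.
Proof.
move=> t0; apply: (deriv_in_ray t0).
have := is_derive_time_cutoff T k t => d; exact: is_derive_eq.
Qed.

(** This allows testing on the vertices alone, or on one open edge: the factor
    al may jump between cells. *)
Lemma test_function_cutoff (o : gpoint G) (rho : R) :
  gconnected G ->
  (forall r : R, 0 < r -> finitely_many_cells (gball o r)) ->
  0 < T -> (forall p, 0 <= al p <= 1) ->
  (forall p, rho < gdist p o -> al p = 0) ->
  (forall e, measurable_fun `]0, elen e[ (al \o epoint e)) ->
  test_function (fun p t => al p * time_cutoff T k t).
Proof.
move=> cG fin T0 al01 al0 mal; split.
- move=> p t t0; have /andP[a0 _] := al01 p.
  by rewrite mulr_ge0// mulr_ge0 ?ramp_ge0 ?plateauX_ge0.
- exists [set p | gdist p o <= rho]; exists (2 * T); first by rewrite mulr_gt0.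
  split; first exact: compact_closed_ball.
  have cA : closed [set p : gpoint G | gdist p o <= rho].
    have /continuous_closedP/(_ _ (@closed_le _ rho)) := @continuous_gdist _ _ o cG.
    exact.
  have cB : closed ([set p : gpoint G | gdist p o <= rho] `*` `[0, 2 * T]%classic).
    have -> : [set p : gpoint G | gdist p o <= rho] `*` `[0, 2 * T]%classic =
        fst @^-1` [set p : gpoint G | gdist p o <= rho] `&`
        snd @^-1` [set` `[0, 2 * T]] by [].
    apply: closedI; [have c1 : continuous (@fst (gpoint G) R)|
                     have c2 : continuous (@snd (gpoint G) R)].
    - by move=> z; exact: cvg_fst.
    - by move/continuous_closedP: c1; apply.
    - by move=> z; exact: cvg_snd.
    - by move/continuous_closedP: c2; apply; exact: itv_closed.
  apply: subset_trans cB; apply: closureS.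
  move=> [p t] /= [t0 pt]; split.
    rewrite leNgt; apply: contra pt => /al0 ->; by rewrite mul0r.
  rewrite in_itv/= t0 leNgt; apply: contra pt => /ltW tT.
  by rewrite /time_cutoff plateau_eq0// exprS !(mul0r, mulr0).
- move=> p.
  apply: (@C1_in_ray _ _ (fun t => al p * time_cutoff' T k t)).
    move=> s; have := is_derive_time_cutoff T k s => d; exact: is_derive_eq.
  by move=> s; apply: cvgM; [exact: cvg_cst|exact: continuous_time_cutoff'].
- move=> e t t0; apply: measurable_funM; [exact: mal|exact: measurable_cst].
- exists (Num.max 1 (2 + 4 * k.+1%:R / T)) => p t t0.
  have /andP[a0 a1] := al01 p.
  split.
    rewrite le_max; apply/orP; left.
    have r0 := ramp_ge0 t0; have r1 := ramp_le1 t.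
    have x0 := plateauX_ge0 T t k.+1.*2.
    have x1 : plateau T t ^+ k.+1.*2 <= 1.
      by rewrite exprn_ile1 ?plateau_ge0 ?plateau_le1.
    by apply: mulr_ile1 => //; [exact: mulr_ge0|exact: mulr_ile1].
  rewrite time_deriv_cutoff// le_max; apply/orP; right.
  rewrite normrM -[leRHS]mul1r ler_pM ?normr_ge0//; first by rewrite ger0_norm.
  exact: time_cutoff'_bounded.
Qed.

End TestFunctions.

(** * Almost everywhere statements and the absorption scheme *)

Section LebesgueHelpers.
Context {R : realType} {d : measure_display} {T : measurableType d}.
Variable mu : {measure set T -> \bar R}.
Local Open Scope ereal_scope.

Lemma ae_le_integral (D : set T) (f g : T -> \bar R) : measurable D ->
  mu.-integrable D f -> mu.-integrable D g ->
  {ae mu, forall t, D t -> f t <= g t} ->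
  \int[mu]_(t in D) f t <= \int[mu]_(t in D) g t.
Proof.
move=> mD intf intg [N [mN N0 subN]].
rewrite (negligible_integral mN mD intf N0) (negligible_integral mN mD intg N0).
have mDN : measurable (D `\` N) by exact: measurableD.
apply: le_integral => //.
- exact: integrableS mD mDN (@subDsetl _ _ _) intf.
- exact: integrableS mD mDN (@subDsetl _ _ _) intg.
move=> t; rewrite inE => -[Dt Nt]; apply: contrapT => fg.
by apply/Nt/subN => /(_ Dt).
Qed.

(** The integral of a nonnegative function is the supremum of the integrals of
    the simple functions below it, whence monotonicity for arbitrary functions.
    This extracts partial sums from the time integrals of a series. *)
Lemma ge0_le_integral_nonmeas (D : set T) (f g : T -> \bar R) :
  (forall t, D t -> 0 <= f t) -> (forall t, D t -> f t <= g t) ->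
  \int[mu]_(t in D) f t <= \int[mu]_(t in D) g t.
Proof.
move=> f0 fg; rewrite integral_mkcond [leRHS]integral_mkcond.
have r0 (h : T -> \bar R) : (forall t, D t -> 0 <= h t) ->
    forall t, 0 <= (h \_ D) t.
  by move=> h0 t; rewrite patchE; case: ifPn => //; rewrite inE => /h0.
have g0 t : D t -> 0 <= g t by move=> Dt; rewrite (le_trans _ (fg t Dt))// f0.
rewrite (ge0_integralTE mu (r0 _ f0)) (ge0_integralTE mu (r0 _ g0)).
apply: ereal_sup_le => _ [h hf <-]; exists h => // t.
apply: (le_trans (hf t)); rewrite !patchE; case: ifPn => //.
by rewrite inE => /fg.
Qed.

Lemma ge0_integrable_le (D : set T) (f : T -> \bar R) (K : R) :
  measurable D -> measurable_fun D f -> (forall t, D t -> 0 <= f t) ->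
  \int[mu]_(t in D) f t <= K%:E -> mu.-integrable D f.
Proof.
move=> mD mf f0 fK; apply/integrableP; split=> //.
rewrite (eq_integral f); first exact: le_lt_trans fK (ltry _).
by move=> t; rewrite inE => /f0 ?; rewrite gee0_abs.
Qed.

Lemma ge0_integral_eq0 (D : set T) (f : T -> \bar R) :
  measurable D -> mu.-integrable D f -> (forall t, D t -> 0 <= f t) ->
  \int[mu]_(t in D) f t = 0 -> {ae mu, forall t, D t -> f t = 0}.
Proof.
move=> mD intf f0 If.
apply/(ae_eq_integral_abs mu mD (measurable_int _ intf)).
by rewrite -[RHS]If; apply: eq_integral => t; rewrite inE => /f0 /gee0_abs.
Qed.

Lemma ae_imp2 (P Q S : T -> Prop) : (forall t, P t -> Q t -> S t) ->
  {ae mu, forall t, P t} -> {ae mu, forall t, Q t} -> {ae mu, forall t, S t}.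
Proof.
move=> PQS aeP aeQ.
exact: (@filterS2 _ _ (ae_filter_ringOfSetsType mu) _ _ _ PQS aeP aeQ).
Qed.

(** The part of the argument common to vertices and edges.  For the n-th test
    function, r n, df n and tr n are the reaction, diffusion and transport
    integrals at a given time, and g n is the weight left by Young's
    inequality.  After integration the pointwise bounds read
    i n.+1 <= lam * (i n.+1 - i n) + K * lam ^ (- p) for the reaction integrals
    i n, whatever lam > 0, which makes them vanish. *)
Lemma absorption_scheme (D : set T) (K p : R)
    (r df tr g : nat -> T -> \bar R) :
  measurable D -> (0 < p)%R -> (0 <= K)%R ->
  (forall n, mu.-integrable D (r n)) ->
  (forall n, mu.-integrable D (df n)) ->
  (forall n, mu.-integrable D (tr n)) ->
  (forall n, measurable_fun D (g n)) ->
  (forall n t, D t -> 0 <= g n t) ->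
  (forall n, \int[mu]_(t in D) g n t <= K%:E) ->
  (forall n t, D t -> 0 <= r n t) ->
  (forall n, {ae mu, forall t, D t -> r n t <= r n.+1 t}) ->
  (forall n, \int[mu]_(t in D) df n t + \int[mu]_(t in D) r n t +
             \int[mu]_(t in D) tr n t <= 0) ->
  (forall n (lam : R), (0 < lam)%R -> {ae mu, forall t, D t ->
     lam%:E * r n t <= lam%:E * r n.+1 t + (df n.+1 t + tr n.+1 t) +
       (lam `^ (- p))%:E * g n.+1 t}) ->
  forall n, \int[mu]_(t in D) r n t = 0.
Proof.
move=> mD p0 K0 ir id it mg g0 gK r0 nd ineq absb.
have ig n := ge0_integrable_le mD (mg n) (g0 n) (gK n).
have fr n : \int[mu]_(t in D) r n t \is a fin_num by exact: integrable_fin_num.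
have fd n : \int[mu]_(t in D) df n t \is a fin_num by exact: integrable_fin_num.
have ft n : \int[mu]_(t in D) tr n t \is a fin_num by exact: integrable_fin_num.
have fg n : \int[mu]_(t in D) g n t \is a fin_num by exact: integrable_fin_num.
pose i n := fine (\int[mu]_(t in D) r n t).
suff i0 : forall n, i n = 0%R.
  by move=> n; rewrite -(fineK (fr n)) [fine _]i0.
apply: (absorption_sequence p0 K0).
- by move=> n; apply/fine_ge0/integral_ge0 => t /r0.
- by move=> n; apply: fine_le => //; exact: ae_le_integral.
move=> lam n lam0.
have idt : mu.-integrable D (fun t => df n.+1 t + tr n.+1 t).
  exact: integrableD.
have irl m : mu.-integrable D (fun t => lam%:E * r m t) by exact: integrableZl.
have irdt : mu.-integrable D
    (fun t => lam%:E * r n.+1 t + (df n.+1 t + tr n.+1 t)).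
  exact: integrableD.
have igl : mu.-integrable D (fun t => (lam `^ (- p))%:E * g n.+1 t).
  exact: integrableZl.
have := ae_le_integral mD (irl n) (integrableD mD irdt igl) (absb n lam lam0).
rewrite !integralD// !integralZl//; move: (ineq n.+1) (gK n.+1).
rewrite -(fineK (fr n)) -(fineK (fr n.+1)) -(fineK (fd n.+1)) -(fineK (ft n.+1)).
rewrite -(fineK (fg n.+1)) -/(i n) -/(i n.+1).
rewrite -!EFinM -!EFinD !lee_fin => h1 h2 h3.
have h4 : (lam `^ (- p) * fine (\int[mu]_(t in D) g n.+1 t) <= K * lam `^ (- p))%R.
  by rewrite mulrC ler_wpM2r// powR_ge0.
lra.
Qed.

End LebesgueHelpers.

Lemma ae_lebesgue_neq (R : realType) (a : R) :
  {ae lebesgue_measure, forall t : R, t <> a}.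
Proof.
exists [set a]; split; [exact: measurable_set1|exact: lebesgue_measure_set1|].
by move=> t /= /contrapT.
Qed.

Lemma ae_forall_count (R : realType) (I : countType) (P : I -> R -> Prop) :
  (forall i, {ae lebesgue_measure, forall t, P i t}) ->
  {ae lebesgue_measure, forall t, forall i, P i t}.
Proof.
move=> aeP.
have aeN : {ae (@lebesgue_measure R), forall t, forall n : nat,
    if unpickle n is Some i then P i t else True}.
  by apply: ae_foralln => n; case: unpickle => [i|]; [exact: aeP|exact: aeW].
apply: (ae_imp2 _ aeN (ae_lebesgue_neq 0)) => t Pt _ i.
by have := Pt (pickle i); rewrite pickleK.
Qed.

(** The nonvanishing set is open, so a null set cannot contain it unless it is
    empty. *)
Lemma ae_eq0_continuous (R : realType) (l : R) (f : R -> R) :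
  (forall s, s \in `]0, l[ -> {for s, continuous f}) ->
  {ae lebesgue_measure, forall s, `]0, l[%classic s -> f s = 0} ->
  forall s, s \in `]0, l[ -> f s = 0.
Proof.
move=> cf [A [mA A0 subA]] s sl; apply: contrapT => /eqP fs.
have nz : \forall y \near s, f y != 0.
  exact: (cvgr_neq0 _ (cf s sl)).
have [e /= e0 eA] : nbhs s A.
  have nI : \forall y \near s, y \in `]0, l[ by exact: near_in_itvoo.
  near=> y; apply: subA => /= /(_ _) fy.
  have yl : y \in `]0, l[ by near: y.
  have : f y != 0 by near: y.
  by rewrite fy// eqxx.
have : (lebesgue_measure (ball s e) <= lebesgue_measure A)%E.
  by apply: le_measure; rewrite ?inE//; exact: measurable_ball.
rewrite A0 ball_itv lebesgue_measure_itv/= lte_fin ltrBlDr -addrA ltrDl addr_gt0//.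
by rewrite -EFinB lee_fin opprB addrC addrA subrK -mulr2n pmulrn_lle0// leNgt e0.
Unshelve. all: by end_near. Qed.

(** * Scales, annuli and their weights *)

Lemma dyadic_cover (R : realDomainType) (a v : R) (N : nat) : 0 <= a -> a <= v ->
  v <= 2 ^+ N.+1 * a ->
  exists2 i, (i < N.+1)%N & 2 ^+ i * a <= v <= 2 * (2 ^+ i * a).
Proof.
move=> a0 av; elim: N => [|N IH] vN.
  by exists 0 => //; rewrite expr0 mul1r av/=; rewrite expr1 in vN.
have [/IH[i iN iv]|/ltW Nv] := leP v (2 ^+ N.+1 * a).
  by exists i => //; exact: (ltn_trans iN).
by exists N.+1 => //; rewrite Nv/= mulrA -exprS.
Qed.

Section Scales.
Context {R : realType}.
Variables (theta1 theta2 : R).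
Hypotheses (th2 : 1 <= theta2) (th12 : theta2 <= theta1).

(** The time at which the term t ^ theta2 balances r ^ theta1. *)
Definition time_scale (r : R) : R := r `^ (theta1 / theta2).

Let th20 : 0 < theta2. Proof. exact: lt_le_trans ltr01 th2. Qed.
Let th10 : 0 < theta1. Proof. exact: lt_le_trans th20 th12. Qed.
Let th121 : 1 <= theta1 / theta2. Proof. by rewrite ler_pdivlMr// mul1r. Qed.

Lemma time_scaleK (r : R) : time_scale r `^ theta2 = r `^ theta1.
Proof. by rewrite /time_scale -powRrM divfK// gt_eqF. Qed.

Lemma time_scale_gt0 (r : R) : 0 < r -> 0 < time_scale r.
Proof. exact: powR_gt0. Qed.

(** Since theta1 >= theta2, the cutoff in time is at least as slow as the one
    in space: its derivative is O(1 / r) as well. *)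
Lemma le_time_scale (r : R) : 1 <= r -> r <= time_scale r.
Proof.
by move=> r1; rewrite -[leLHS]powRr1 ?(le_trans ler01)// ler_powR.
Qed.

Lemma time_scale_triple (r : R) : 0 < r -> 3 * time_scale r <= time_scale (3 * r).
Proof.
move=> r0; rewrite /time_scale powRM ?(ltW r0)// ler_wpM2r ?powR_ge0//.
by rewrite -[leLHS]powRr1// ler_powR// ler1n.
Qed.

(** The radii for which consecutive annuli are adjacent: raising them to the
    power theta1 gives the dyadic multiples of r ^ theta1. *)
Definition dyadic_radius (r : R) (i : nat) : R := r * (2 ^+ i) `^ theta1^-1.

Lemma dyadic_radiusX (r : R) (i : nat) : 0 <= r ->
  dyadic_radius r i `^ theta1 = 2 ^+ i * r `^ theta1.
Proof.
move=> r0; rewrite /dyadic_radius powRM ?powR_ge0// -powRrM mulVf ?gt_eqF//.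
by rewrite powRr1 ?exprn_ge0// mulrC.
Qed.

Lemma dyadic_radius_ge (r : R) (i : nat) : 0 <= r -> r <= dyadic_radius r i.
Proof.
move=> r0; rewrite -[leLHS]mulr1 ler_wpM2l//.
have e1 : 1 `^ theta1^-1 = 1 :> R by rewrite powR1.
rewrite -[leLHS]e1.
apply: ge0_ler_powR; rewrite ?nnegrE ?exprn_ge0 ?invr_ge0 ?(ltW th10)//.
by rewrite exprn_ege1 ?ler1n.
Qed.

(** Where a cutoff at scale r is neither 0 nor locally constant, the quantity
    d ^ theta1 + t ^ theta2 is comparable to r ^ theta1 up to the factor
    3 ^ theta1 + 2 ^ theta2; a number of annuli independent of r suffices. *)
Lemma transition_cover : exists N : nat, forall r d t : R,
  0 < r -> 0 <= d <= 3 * r -> 0 <= t <= 2 * time_scale r ->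
  (r <= d) || (time_scale r <= t) ->
  exists2 i, (i < N)%N &
    dyadic_radius r i `^ theta1 <= d `^ theta1 + t `^ theta2 <=
    2 * dyadic_radius r i `^ theta1.
Proof.
pose c := 3 `^ theta1 + 2 `^ theta2.
have c0 : 0 <= c by rewrite addr_ge0// powR_ge0.
have [N cN] : exists N : nat, c <= 2 ^+ N.+1 :> R.
  exists (Num.bound c); apply: (le_trans (ltW (archi_boundP c0))).
  rewrite -natrX ler_nat.
  by apply: leq_trans (ltnW (ltn_expl (Num.bound c) (isT : (1 < 2)%N))) _;
    rewrite leq_pexp2l.
exists N.+1 => r d t r0 /andP[d0 d3] /andP[t0 t2] rdt.
have a0 : 0 <= r `^ theta1 by exact: powR_ge0.
have mono (y x z : R) : 0 <= y -> 0 <= x -> 0 < z -> x <= y -> x `^ z <= y `^ z.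
  by move=> ? ? /ltW z0 xy; apply: ge0_ler_powR; rewrite ?nnegrE.
have Tr0 := ltW (time_scale_gt0 r0).
have lo : r `^ theta1 <= d `^ theta1 + t `^ theta2.
  case/orP: rdt => [rd|Tt].
    by rewrite -[leLHS]addr0 lerD ?powR_ge0// mono// ltW.
  by rewrite -[leLHS]add0r lerD ?powR_ge0// -time_scaleK mono.
have hi : d `^ theta1 + t `^ theta2 <= 2 ^+ N.+1 * r `^ theta1.
  apply: (@le_trans _ _ (c * r `^ theta1)); last by rewrite ler_wpM2r.
  rewrite mulrDl lerD//.
    by rewrite -powRM// ?(ltW r0)// mono// mulr_ge0// ltW.
  by rewrite -time_scaleK -powRM// mono// mulr_ge0.
have [i iN iv] := dyadic_cover a0 lo hi.
by exists i => //; rewrite dyadic_radiusX// ltW.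
Qed.

(** The factor r ^ (- q) produced by derivatives of the cutoffs compensates the
    growth r ^ q allowed by hypothesis: the bound does not depend on r. *)
Lemma dyadic_weight_integral (D : set R) (w : R -> R -> \bar R)
    (kap q C r : R) (N : nat) :
  measurable D -> 0 <= kap -> 0 <= C -> 0 < r ->
  (forall i, measurable_fun D (w (dyadic_radius r i))) ->
  (forall i t, D t -> (0 <= w (dyadic_radius r i) t)%E) ->
  (forall i, (\int[lebesgue_measure]_(t in D) w (dyadic_radius r i) t <=
    (C * dyadic_radius r i `^ q)%:E)%E) ->
  (\int[lebesgue_measure]_(t in D)
     (((kap / r) `^ q)%:E * \sum_(i < N) w (dyadic_radius r i) t) <=
   (kap `^ q * C * \sum_(i < N) ((2 ^+ i) `^ theta1^-1) `^ q)%:E)%E.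
Proof.
move=> mD k0 C0 r0 mw w0 wC.
rewrite ge0_integralZl//; last 3 first.
- by apply: emeasurable_sum => i; exact: mw.
- by move=> t Dt; apply: sume_ge0 => i _; exact: w0.
- by rewrite lee_fin powR_ge0.
rewrite ge0_integral_sum//; [|by move=> i; exact: mw|by move=> i t Dt; exact: w0].
apply: (@le_trans _ _ (((kap / r) `^ q)%:E *
    (\sum_(i < N) C * dyadic_radius r i `^ q)%:E)%E).
  rewrite lee_wpmul2l ?lee_fin ?powR_ge0// -sumEFin; apply: lee_sum => i _.
  exact: wC.
rewrite -EFinM lee_fin le_eqVlt; apply/orP; left; apply/eqP.
rewrite !mulr_sumr; apply: eq_bigr => i _.
rewrite /dyadic_radius !powRM ?powR_ge0 ?invr_ge0 ?(ltW r0)//.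
have rq : r^-1 `^ q * r `^ q = 1.
  by rewrite -powRM ?invr_ge0 ?(ltW r0)// mulVf ?gt_eqF// powR1.
rewrite -[RHS]mulr1 -rq; ring.
Qed.

End Scales.

Section Radii.
Context {R : realType}.
Variable rho : R.
Hypothesis rho1 : 1 <= rho.

(** The ratio 3 makes each cutoff vanish on the transition zone of the next
    one. *)
Definition radius (n : nat) : R := rho * 3 ^+ n.

Lemma radiusS n : radius n.+1 = 3 * radius n.
Proof. by rewrite /radius exprS; ring. Qed.

Lemma radius_ge n : rho <= radius n.
Proof.
by rewrite -[leLHS]mulr1 ler_wpM2l ?exprn_ege1 ?ler1n// (le_trans _ rho1).
Qed.

Lemma radius_gt0 n : 0 < radius n.
Proof. by apply: lt_le_trans (radius_ge n); apply: lt_le_trans rho1. Qed.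

Lemma radius_homo n m : (n <= m)%N -> radius n <= radius m.
Proof.
by move=> nm; rewrite ler_wpM2l ?(le_trans _ rho1)// ler_weXn2l// ler1n.
Qed.

Lemma radius_unbounded (M : R) : exists n, M <= radius n.
Proof.
exists (Num.bound `|M|); apply: (le_trans (ler_norm M)).
apply: (le_trans (ltW (archi_boundP (normr_ge0 M)))).
apply: (@le_trans _ _ (3 ^+ Num.bound `|M|)); last first.
  by rewrite -[leLHS]mul1r ler_wpM2r// exprn_ge0.
by rewrite -natrX ler_nat ltnW// ltn_expl.
Qed.

End Radii.

Lemma exists_even_exponent (R : realType) (q : R) : 0 <= q ->
  exists k : nat, q <= k.+1.*2%:R.
Proof.
move=> q0; exists (Num.bound q); apply: (le_trans (ltW (archi_boundP q0))).
by rewrite ler_nat -addnn (leq_trans (leqnSn _))// leq_addr.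
Qed.

Section AnnulusWeight.
Context {R : realType} {G : metricGraph R}.
Variables (x0 : vertex G) (h : gpoint G -> R -> R) (p theta1 theta2 : R).

(** The integrand of the two growth hypotheses. *)
Definition annulus_weight (r : R) (z : gpoint G) (t : R) : R :=
  h z t `^ (- p) * \1_(annulus x0 theta1 theta2 r) (z, t).

Lemma annulus_weight_ge0 (r : R) z t : 0 <= annulus_weight r z t.
Proof. by rewrite mulr_ge0// ?powR_ge0// indicE. Qed.

Lemma measurable_annulus_weight (e : edge G) (r : R) :
  gconnected G -> edge_measurable h ->
  measurable_fun (`[0, elen e] `*` `[0, +oo[ : set (R * R))
    (fun z => annulus_weight r (epoint e z.1) z.2).
Proof.
move=> cG mh; apply: measurable_funM.
  apply: (measurableT_comp (measurable_powR _)); exact: mh.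
pose f (z : R * R) :=
  gdist (epoint e z.1) (Vertex x0) `^ theta1 + z.2 `^ theta2.
have mf : measurable_fun [set: R * R] f.
  apply: measurable_funD.
    apply: (measurableT_comp (measurable_powR _)).
    apply: (measurableT_comp (f := fun s => gdist (epoint e s) (Vertex x0)));
      last exact: measurable_fst.
    apply: continuous_measurable_fun => s.
    apply: (@continuous_comp _ _ _ (epoint e) (fun p => gdist p (Vertex x0))).
      exact: continuous_epoint.
    exact: continuous_gdist.
  apply: (measurableT_comp (measurable_powR _)); exact: measurable_snd.
pose A : set (R * R) := f @^-1` `[r `^ theta1, 2 * r `^ theta1]%classic `&`
  snd @^-1` `[0, +oo[%classic.
have mA : measurable A.
  apply: measurableI.
    by rewrite -[X in measurable X]setTI; exact: mf.
  by rewrite -[X in measurable X]setTI; exact: measurable_snd.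
rewrite (_ : (fun z => _) = \1_A).
  exact: measurable_funTS (measurable_indic mA).
apply/funext => -[s t]; rewrite !indicE; congr (_%:R); congr (nat_of_bool _).
apply/idP/idP; rewrite !inE /A /annulus /f /= !in_itv/= andbT.
  by move=> [].
by move=> [].
Qed.

Lemma measurable_annulus_weight_section (e : edge G) (r s : R) :
  gconnected G -> edge_measurable h -> 0 <= s <= elen e ->
  measurable_fun (`[0, +oo[ : set R) (annulus_weight r (epoint e s)).
Proof.
move=> cG mh s01.
apply: (@measurable_comp _ _ _ _ _ _
  (`[0, elen e] `*` `[0, +oo[ : set (R * R))
  (fun z => annulus_weight r (epoint e z.1) z.2) _ (pair s)).
- exact: measurableX.
- by move=> _ [t t0 <-]; split.
- exact: measurable_annulus_weight.
- exact: measurable_funTS (pair1_measurable s).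
Qed.

Lemma measurable_annulus_weight_time (e : edge G) (r t : R) :
  gconnected G -> edge_measurable h -> 0 <= t ->
  measurable_fun (`]0, elen e[ : set R)
    (fun s => annulus_weight r (epoint e s) t).
Proof.
move=> cG mh t0.
apply: (@measurable_comp _ _ _ _ _ _
  (`[0, elen e] `*` `[0, +oo[ : set (R * R))
  (fun z => annulus_weight r (epoint e z.1) z.2) _ (pair^~ t)).
- exact: measurableX.
- move=> _ [s sl <-]; split=> //=; last by rewrite in_itv/= andbT.
  by move: sl; rewrite /= !in_itv/= => /andP[/ltW -> /ltW ->].
- exact: measurable_annulus_weight.
- exact: measurable_funTS (pair2_measurable t).
Qed.

(** Tonelli's theorem, for the extension by 0 outside the open edge. *)
Lemma measurable_integral_annulus_weight (e : edge G) (r : R) :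
  gconnected G -> edge_measurable h ->
  measurable_fun (`[0, +oo[ : set R) (fun t =>
    \int[lebesgue_measure]_(s in `]0%R, elen e[)
      (annulus_weight r (epoint e s) t)%:E)%E.
Proof.
move=> cG mh.
pose P : set (R * R) := `]0, elen e[%classic `*` `[0, +oo[%classic.
pose w (z : R * R) := (annulus_weight r (epoint e z.1) z.2)%:E.
have mP : measurable P by exact: measurableX.
have mw : measurable_fun P w.
  apply/measurable_EFinP; apply: measurable_funS (measurable_annulus_weight r cG mh).
    exact: measurableX.
  move=> [s t] [/= s01 t0]; split=> //=.
  by move: s01; rewrite !in_itv/= => /andP[/ltW -> /ltW ->].
have mF : measurable_fun [set: R * R] (w \_ P) by exact/(measurable_restrictT _ mP).
have F0 z : (0 <= (w \_ P) z)%E.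
  by rewrite patchE; case: ifPn => // _; rewrite lee_fin annulus_weight_ge0.
have mG := @measurable_fun_fubini_tonelli_G _ _ _ _ _
  (@lebesgue_measure R) (w \_ P) mF F0.
apply: eq_measurable_fun (measurable_funTS mG) => t.
rewrite inE => t0; rewrite /fubini_G [RHS]integral_mkcond; apply: eq_integral => s _.
rewrite !patchE; congr (if _ then _ else _).
by apply/idP/idP; rewrite !inE; [case|].
Qed.

End AnnulusWeight.

(** * Absorption at a point, and Green's formula on the vertices *)

Section PointwiseAbsorption.
Context {R : realType} {G : metricGraph R}.
Variables (x0 : vertex G) (h : gpoint G -> R -> R) (sigma theta1 theta2 : R).
Variables (N k : nat).
Hypotheses (s1 : 1 < sigma) (th2 : 1 <= theta2) (th12 : theta2 <= theta1).
Hypothesis cG : gconnected G.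
Hypothesis coverN : forall r d t : R,
  0 < r -> 0 <= d <= 3 * r -> 0 <= t <= 2 * time_scale theta1 theta2 r ->
  (r <= d) || (time_scale theta1 theta2 r <= t) ->
  exists2 i, (i < N)%N &
    dyadic_radius theta1 r i `^ theta1 <= d `^ theta1 + t `^ theta2 <=
    2 * dyadic_radius theta1 r i `^ theta1.
Hypothesis qk : sigma / (sigma - 1) <= k.+1.*2%:R.

Local Notation T := (time_scale theta1 theta2).
Local Notation gd p := (gdist p (Vertex x0)).
Local Notation weight r := (annulus_weight x0 h (sigma - 1)^-1 theta1 theta2 r).

(** A1 and A2 are the values at z of the cutoffs in space at scales r and 3 r.
    Outside the transition zone of scale 3 r the left side is 0, and the right
    side is nonnegative because the cutoffs increase with the scale.  On the
    zone the cutoff of scale r is 0, so that Young's inequality may use the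
    difference of the two cutoffs, and one of the annuli contains the point, so
    that the weight is at least h ^ (- 1 / (sigma - 1)). *)
Lemma transition_absorption (z : gpoint G) (t r kap lam X A1 A2 : R) :
  0 <= t -> 0 < r -> 0 <= kap -> 0 < lam -> 0 <= X -> 0 < h z t ->
  0 <= A1 -> A1 <= A2 -> A2 <= 1 ->
  (3 * r <= gd z -> A1 = 0) -> (9 * r < gd z -> A2 = 0) ->
  X * (ramp t * (A2 * plateau (T (3 * r)) t) ^+ k.*2.+1 * (kap / (3 * r))) *
    ((3 * r <= gd z) || (T (3 * r) <= t))%R%:R <=
  lam * (h z t * X `^ sigma * (A2 ^+ k.+1.*2 * time_cutoff (T (3 * r)) k t)) -
  lam * (h z t * X `^ sigma * (A1 ^+ k.+1.*2 * time_cutoff (T r) k t)) +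
  lam `^ (- (sigma - 1)^-1) * ((kap / (3 * r)) `^ (sigma / (sigma - 1)) *
    \sum_(i < N) weight (dyadic_radius theta1 (3 * r) i) z t).
Proof.
move=> t0 r0 k0 l0 X0 h0 A10 A12 A21 A1z A2z.
have r30 : 0 < 3 * r by rewrite mulr_gt0.
have Tr0 := time_scale_gt0 theta1 theta2 r0.
have Tr30 := time_scale_gt0 theta1 theta2 r30.
have Tr3 := time_scale_triple th2 th12 r0.
set b1 := plateau (T r) t; set b2 := plateau (T (3 * r)) t.
have b10 : 0 <= b1 := plateau_ge0 _ _.
have b20 : 0 <= b2 := plateau_ge0 _ _.
have b21 : b2 <= 1 := plateau_le1 _ _.
have b12 : b1 <= b2 by apply: plateau_homo => //; lra.
have ra0 := ramp_ge0 t0; have ra1 := ramp_le1 t.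
have aX0 : 0 <= h z t * X `^ sigma by rewrite mulr_ge0 ?powR_ge0// ltW.
have A20 : 0 <= A2 by apply: le_trans A12.
pose w := \sum_(i < N) weight (dyadic_radius theta1 (3 * r) i) z t.
have w0 : 0 <= w by apply: sumr_ge0 => i _; exact: annulus_weight_ge0.
pose m := k.*2.+1; rewrite -/w.
have E (A b : R) : A ^+ k.+1.*2 * (ramp t * b ^+ k.+1.*2) = ramp t * (A * b) ^+ m.+1.
  by rewrite exprMn -/m; ring.
rewrite /time_cutoff !E -/b1 -/b2 -/m.
have z01 : 0 <= A2 * b2 <= 1 by rewrite mulr_ge0//= mulr_ile1.
have W0 : 0 <= lam `^ (- (sigma - 1)^-1) *
    ((kap / (3 * r)) `^ (sigma / (sigma - 1)) * w).
  by rewrite !mulr_ge0 ?powR_ge0.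
have [bad|good] := boolP ((3 * r <= gd z) || (T (3 * r) <= t)); last first.
  rewrite mulr0 addr_ge0// subr_ge0 ler_wpM2l ?(ltW l0)// ler_wpM2l//.
  rewrite ler_wpM2l//; apply: lerXn2r; rewrite ?nnegrE ?mulr_ge0//.
  exact: ler_pM.
rewrite mulr1.
have -> : ramp t * (A1 * b1) ^+ m.+1 = 0.
  case/orP: bad => [/A1z ->|Tt]; first by rewrite mul0r expr0n mulr0.
  have -> : b1 = 0 by apply: plateau_eq0 => //; lra.
  by rewrite mulr0 expr0n mulr0.
rewrite !mulr0 subr0.
have [z0|zn0] := eqVneq (A2 * b2) 0.
  by rewrite z0 !expr0n/= !(mulr0, mul0r) add0r.
have wh : h z t `^ (- (sigma - 1)^-1) <= w.
  have d3 : 0 <= gd z <= 3 * (3 * r).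
    rewrite gdist_ge0//= leNgt; apply: contra zn0 => d9.
    by rewrite A2z ?mul0r//; lra.
  have t3 : 0 <= t <= 2 * T (3 * r).
    rewrite t0/= leNgt; apply: contra zn0 => t9.
    by rewrite /b2 plateau_eq0 ?mulr0// ltW.
  have [i iN iv] := coverN r30 d3 t3 bad.
  rewrite /w (bigD1 (Ordinal iN))//= -[leLHS]addr0 lerD//; last first.
    by apply: sumr_ge0 => ? _; exact: annulus_weight_ge0.
  by rewrite /annulus_weight indicE mem_set ?mulr1.
have c0 : 0 <= kap / (3 * r) by rewrite divr_ge0// ltW.
have := absorption_pointwise s1 l0 c0 X0 h0 z01 (m := m) qk.
move=> /(ler_wpM2l ra0) Y.
have -> : X * (ramp t * (A2 * b2) ^+ m * (kap / (3 * r))) =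
  ramp t * (X * (kap / (3 * r)) * (A2 * b2) ^+ m) by ring.
apply: (le_trans Y); rewrite mulrDr lerD//.
  by rewrite le_eqVlt; apply/orP; left; apply/eqP; ring.
apply: (@le_trans _ _ (1 * (lam `^ (- (sigma - 1)^-1) *
    (kap / (3 * r)) `^ (sigma / (sigma - 1)) * h z t `^ (- (sigma - 1)^-1)))).
  by rewrite ler_wpM2r// !mulr_ge0 ?powR_ge0.
by rewrite mul1r -mulrA ler_wpM2l ?powR_ge0// ler_wpM2l ?powR_ge0.
Qed.

End PointwiseAbsorption.

Section GreenFormula.
Context {R : realType} {G : metricGraph R} (W : weights G).

Lemma omega_eq0 (x y : vertex G) : ~ adj x y -> omega W x y = 0.
Proof.
move=> nxy; apply/eqP; rewrite eq_le omega_ge0 andbT leNgt.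
by apply/negP => /omega_gt0.
Qed.

Lemma fsum_adj (S : set (vertex G)) (x : vertex G) (F : vertex G -> R) :
  [set y | adj x y] `<=` S ->
  \sum_(y \in [set y | adj x y]) omega W x y * F y =
  \sum_(y \in S) omega W x y * F y.
Proof.
move=> aS; apply: fsbig_widen => // y [Sy nxy] /=.
by rewrite omega_eq0// mul0r.
Qed.

(** Both sides are double sums over S: the weights vanish off the neighbours,
    and the symmetry of omega exchanges the two indices. *)
Lemma green_formula (S : set (vertex G)) (al v : vertex G -> R) :
  finite_set S -> (forall x, al x != 0 -> [set y | adj x y] `<=` S) ->
  \sum_(x \in S) al x *
    (\sum_(y \in [set y | adj x y]) omega W x y * (v y - v x)) =
  \sum_(x \in S) v x * (\sum_(y \in S) omega W x y * (al y - al x)).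
Proof.
move=> fS alS.
transitivity (\sum_(x \in S) \sum_(y \in S)
    (omega W x y * al x * v y - omega W x y * al x * v x)).
  apply: eq_fsbigr => x _; have [->|/alS aS] := eqVneq (al x) 0.
    by rewrite mul0r fsbig_finite// big1// => y _; rewrite !mulr0 !mul0r subrr.
  rewrite (fsum_adj _ aS) !fsbig_finite// mulr_sumr; apply: eq_bigr => y _; ring.
rewrite !fsbig_finite//.
under eq_bigr => x _ do rewrite fsbig_finite// sumrB.
under [RHS]eq_bigr => x _ do rewrite fsbig_finite// mulr_sumr.
rewrite sumrB exchange_big/= -sumrB; apply: eq_bigr => x _.
rewrite -sumrB; apply: eq_bigr => y _; rewrite (omega_sym W y x); ring.
Qed.

End GreenFormula.

(** * Vanishing at the vertices *)

Section SpaceCutoff.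
Context {R : realType}.

Definition space_cutoff (r d : R) : R := Num.max 0 (Num.min 1 (3 - d / r)).

Lemma space_cutoff_ge0 (r d : R) : 0 <= space_cutoff r d.
Proof. by rewrite le_max lexx. Qed.

Lemma space_cutoff_le1 (r d : R) : space_cutoff r d <= 1.
Proof. by rewrite ge_max ler01 ge_min lexx. Qed.

Lemma space_cutoff_eq1 (r d : R) : 0 < r -> d <= 2 * r -> space_cutoff r d = 1.
Proof.
move=> r0; rewrite -ler_pdivrMr// => d2.
by rewrite /space_cutoff min_l ?max_r//; lra.
Qed.

Lemma space_cutoff_eq0 (r d : R) : 0 < r -> 3 * r <= d -> space_cutoff r d = 0.
Proof.
move=> r0; rewrite -ler_pdivlMr// => d3.
by apply: max_l; rewrite ge_min; apply/orP; right; lra.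
Qed.

Lemma space_cutoff_homo (r1 r2 d : R) : 0 <= d -> 0 < r1 -> r1 <= r2 ->
  space_cutoff r1 d <= space_cutoff r2 d.
Proof.
move=> d0 r0 r12; have r20 : 0 < r2 by apply: lt_le_trans r12.
have : d / r2 <= d / r1 by rewrite ler_wpM2l// lef_pV2.
rewrite /space_cutoff => ?.
have [?|?] := leP 1 (3 - d / r1); have [?|?] := leP 1 (3 - d / r2);
  rewrite ?(max_r ler01) ?space_cutoff_le1//; try lra;
  rewrite ?ge_max ?le_max ?ler01 ?lexx ?orbT//=; lra.
Qed.

Lemma space_cutoff_lipschitz (r d d' c : R) : 0 < r -> `|d - d'| <= c ->
  space_cutoff r d - space_cutoff r d' <= c / r.
Proof.
move=> r0 dc; have : (d' - d) / r <= c / r.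
  rewrite ler_wpM2r ?invr_ge0 ?(ltW r0)//; apply: le_trans dc.
  by rewrite distrC ler_norm.
have : 0 <= c / r by rewrite divr_ge0 ?(ltW r0)// (le_trans _ dc).
rewrite mulrBl /space_cutoff.
by have [?|?] := leP 1 (3 - d / r); have [?|?] := leP 1 (3 - d' / r);
  rewrite ?(max_r ler01); [|have [?|?] := leP 0 (3 - d' / r)
                         |have [?|?] := leP 0 (3 - d / r)
   |have [?|?] := leP 0 (3 - d / r); have [?|?] := leP 0 (3 - d' / r)]; lra.
Qed.

End SpaceCutoff.

Section VertexGreen.
Context {R : realType} {G : metricGraph R} (W : weights G).
Variables (x0 : vertex G) (j C0 : R).
Hypotheses (cG : gconnected G) (j0 : 0 <= j) (lej : forall e : edge G, elen e <= j).
Hypothesis omC0 : forall x : vertex G,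
  \sum_(y \in [set y | adj x y]) omega W x y <= C0 * muV W x.

Local Notation gd x := (gdist (Vertex x) (Vertex x0)).

Lemma adj_gdist (x y : vertex G) : adj x y -> `|gd x - gd y| <= j.
Proof.
move=> /adj_gpath[e xy]; apply: le_trans (lej e).
exact: gdist_lipschitz.
Qed.

(** By Green's formula the Laplacian falls on the power of the cutoff.  Only its
    negative part matters, and by convexity of the power a decrease along an
    edge is at most (m + 2) A ^ (m + 1) times the decrease of A, which is at
    most j / r and occurs only at distance at least r: closer in, A = 1 at
    both ends.  Where A = 0 the contribution is nonnegative. *)
Lemma cutoff_laplacian_ge (S : set (vertex G)) (r : R) (m : nat)
    (v : vertex G -> R) :
  finite_set S -> 0 < r -> j <= r ->
  (forall x, gd x <= 4 * r -> S x) -> (forall x, 0 <= v x) ->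
  - \sum_(x \in S) muV W x * (v x *
      (space_cutoff r (gd x) ^+ m.+1 * (C0 * m.+2%:R * j / r)) *
      (r <= gd x)%R%:R) <=
  \sum_(x \in S) space_cutoff r (gd x) ^+ m.+2 *
    (\sum_(y \in [set y | adj x y]) omega W x y * (v y - v x)).
Proof.
move=> fS r0 jr inS v0; set A := fun x => space_cutoff r (gd x).
have adjS x : A x != 0 -> [set y | adj x y] `<=` S.
  move=> Ax y /adj_gdist; rewrite ler_norml => /andP[xy _]; apply: inS.
  have : gd x < 3 * r.
    by rewrite ltNge; apply: contra Ax => ?; rewrite /A space_cutoff_eq0.
  lra.
rewrite (@green_formula _ _ W S (fun x => A x ^+ m.+2) v fS); last first.
  by move=> x; rewrite expf_eq0/= => /adjS.
rewrite !fsbig_finite// -sumrN; apply: ler_sum => x _.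
set b := (r <= gd x)%R%:R : R.
have A0 y : 0 <= A y := space_cutoff_ge0 _ _.
have [Ax|Ax] := eqVneq (A x) 0.
  rewrite -/(A x) Ax exprS !(mul0r, mulr0) oppr0 mulr_ge0//.
  rewrite fsbig_finite// sumr_ge0// => y _.
  by rewrite expr0n subr0 mulr_ge0 ?omega_ge0// exprn_ge0.
pose B := m.+2%:R * A x ^+ m.+1 * (j / r * b).
have B0 : 0 <= B.
  by rewrite !mulr_ge0 ?exprn_ge0// ?invr_ge0 ?(ltW r0)// /b; case: (_ <= _).
have AB y : omega W x y * - B <= omega W x y * (A y ^+ m.+2 - A x ^+ m.+2).
  have [xy|nxy] := pselect (adj x y); last by rewrite omega_eq0// !mul0r.
  rewrite ler_wpM2l ?omega_ge0// lerNl opprB.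
  apply: (le_trans (exprB_le_tangent m.+1 (A0 x) (A0 y))).
  rewrite ler_wpM2l ?mulr_ge0 ?exprn_ge0// /b.
  have dxy := adj_gdist xy.
  have [rx|xr] := leP r (gd x); first by rewrite mulr1 space_cutoff_lipschitz.
  move: dxy; rewrite ler_norml => /andP[dxy _].
  by rewrite mulr0 /A !space_cutoff_eq1 ?subrr//; lra.
apply: (@le_trans _ _ (v x * (C0 * muV W x * - B))).
  rewrite le_eqVlt; apply/orP; left; apply/eqP.
  by rewrite /B -/(A x); ring.
rewrite ler_wpM2l//.
apply: (@le_trans _ _ (\sum_(y \in S) omega W x y * - B)).
  rewrite fsbig_finite// -mulr_suml ler_wnM2r ?oppr_le0//.
  have := fsum_adj W (fun=> 1) (adjS x Ax).
  rewrite [RHS]fsbig_finite//; under eq_fsbigr => y _ do rewrite mulr1.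
  under [RHS]eq_bigr => y _ do rewrite mulr1.
  by move=> <-; exact: omC0.
by rewrite !fsbig_finite//; apply: ler_sum => y _; exact: AB.
Qed.

End VertexGreen.

Section VertexTransition.
Context {R : realType} {G : metricGraph R} (W : weights G).
Variables (x0 : vertex G) (h : gpoint G -> R -> R) (sigma theta1 theta2 : R).
Variables (j C0 : R) (N k : nat).
Hypotheses (s1 : 1 < sigma) (th2 : 1 <= theta2) (th12 : theta2 <= theta1).
Hypotheses (cG : gconnected G) (j0 : 0 <= j) (lej : forall e : edge G, elen e <= j).
Hypothesis C00 : 0 <= C0.
Hypothesis omC0 : forall x : vertex G,
  \sum_(y \in [set y | adj x y]) omega W x y <= C0 * muV W x.
Hypothesis hpos : forall p t, 0 <= t -> 0 < h p t.
Hypothesis coverN : forall r d t : R,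
  0 < r -> 0 <= d <= 3 * r -> 0 <= t <= 2 * time_scale theta1 theta2 r ->
  (r <= d) || (time_scale theta1 theta2 r <= t) ->
  exists2 i, (i < N)%N &
    dyadic_radius theta1 r i `^ theta1 <= d `^ theta1 + t `^ theta2 <=
    2 * dyadic_radius theta1 r i `^ theta1.
Hypothesis qk : sigma / (sigma - 1) <= k.+1.*2%:R.

Local Notation T := (time_scale theta1 theta2).
Local Notation gd x := (gdist (Vertex x) (Vertex x0)).
Local Notation weight r := (annulus_weight x0 h (sigma - 1)^-1 theta1 theta2 r).

(** r times a bound on the rate lost by the cutoffs of scale r: in space, where
    the Laplacian contributes C0, and in time. *)
Definition vertex_rate : R := C0 * k.+1.*2%:R * j + 4 * k.+1%:R.

Lemma vertex_rate_ge0 : 0 <= vertex_rate.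
Proof. by rewrite addr_ge0 ?mulr_ge0. Qed.

(** The hypothesis of the absorption scheme at a given time, for cutoffs of
    scales r and 3 r: the errors of the diffusion and of the transport terms
    are both of the form treated by transition_absorption. *)
Lemma vertex_transition (S : set (vertex G)) (t r lam : R) (v : vertex G -> R) :
  finite_set S -> 0 <= t -> 0 < r -> j <= 3 * r -> 1 <= 3 * r -> 0 < lam ->
  (forall x, gd x <= 4 * (3 * r) -> S x) -> (forall x, 0 <= v x) ->
  lam * \sum_(x \in S) muV W x * (h (Vertex x) t * v x `^ sigma *
    (space_cutoff r (gd x) ^+ k.+1.*2 * time_cutoff (T r) k t)) <=
  lam * \sum_(x \in S) muV W x * (h (Vertex x) t * v x `^ sigma *
    (space_cutoff (3 * r) (gd x) ^+ k.+1.*2 * time_cutoff (T (3 * r)) k t)) +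
  (time_cutoff (T (3 * r)) k t *
     \sum_(x \in S) space_cutoff (3 * r) (gd x) ^+ k.+1.*2 *
       (\sum_(y \in [set y | adj x y]) omega W x y * (v y - v x)) +
   \sum_(x \in S) muV W x * (v x *
     (space_cutoff (3 * r) (gd x) ^+ k.+1.*2 * time_cutoff' (T (3 * r)) k t))) +
  lam `^ (- (sigma - 1)^-1) *
    ((vertex_rate / (3 * r)) `^ (sigma / (sigma - 1)) *
     \sum_(i < N) \sum_(x \in S)
        muV W x * weight (dyadic_radius theta1 (3 * r) i) (Vertex x) t).
Proof.
move=> fS t0 r0 jr r1 l0 inS v0.
have r30 : 0 < 3 * r by rewrite mulr_gt0.
have := cutoff_laplacian_ge cG j0 lej omC0 k.*2 fS r30 jr inS v0.
set Lap := (X in _ <= X); set Bad := (X in - X <= _) => hLap.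
have Tr0 := time_scale_gt0 theta1 theta2 r30.
have rT := le_time_scale th2 th12 r1.
set ta := time_cutoff (T (3 * r)) k t.
set b := plateau (T (3 * r)) t.
have ra0 := ramp_ge0 t0.
have b0 : 0 <= b := plateau_ge0 _ _.
have b1 : b <= 1 := plateau_le1 _ _.
have ta0 : 0 <= ta by rewrite mulr_ge0// plateauX_ge0.
have hta := ler_wpM2l ta0 hLap.
pose A r x := space_cutoff r (gd x).
have A0 r' x : 0 <= A r' x := space_cutoff_ge0 _ _.
have A1 r' x : A r' x <= 1 := space_cutoff_le1 _ _.
pose m := k.*2.+1.
pose err x := v x * (ramp t * (A (3 * r) x * b) ^+ m * (vertex_rate / (3 * r))) *
    ((3 * r <= gd x) || (T (3 * r) <= t))%R%:R.
(* Diffusion and transport errors at x, merged into one on the zone. *)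
have err_ge x : ta * (muV W x * (v x *
      (A (3 * r) x ^+ m * (C0 * k.*2.+2%:R * j / (3 * r))) *
      (3 * r <= gd x)%R%:R)) - muV W x * (v x *
      (A (3 * r) x ^+ k.+1.*2 * time_cutoff' (T (3 * r)) k t)) <=
    muV W x * err x.
  have mu0 : 0 <= muV W x by rewrite ltW// muV_gt0.
  have P0 : 0 <= ramp t * (A (3 * r) x * b) ^+ m.
    by rewrite mulr_ge0// exprn_ge0// mulr_ge0.
  have h1 : ta * A (3 * r) x ^+ m <= ramp t * (A (3 * r) x * b) ^+ m.
    rewrite -[leRHS]mulr1 [leLHS](_ : _ = ramp t * (A (3 * r) x * b) ^+ m * b).
      by rewrite ler_wpM2l.
    by rewrite /ta /time_cutoff -/b [b ^+ _]exprSr exprMn; ring.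
  have h2 : A (3 * r) x ^+ k.+1.*2 * - time_cutoff' (T (3 * r)) k t <=
      ramp t * (A (3 * r) x * b) ^+ m * (4 * k.+1%:R / (3 * r)) *
      (T (3 * r) <= t)%R%:R.
    have h3 := time_cutoff'_ge k t0 Tr0.
    apply: (le_trans (ler_wpM2l (exprn_ge0 _ (A0 _ _)) h3)).
    rewrite mulrA ler_wpM2r//.
    rewrite [leLHS](_ : _ = ramp t * (A (3 * r) x * b) ^+ m *
      (A (3 * r) x * (4 * k.+1%:R / T (3 * r)))); last first.
      by rewrite [_ ^+ k.+1.*2]exprSr exprMn -/m -/b; ring.
    rewrite ler_wpM2l// -[leRHS]mul1r ler_pM// ?divr_ge0 ?(ltW Tr0)//.
    by rewrite ler_wpM2l// lef_pV2.
  rewrite [leLHS](_ : _ = muV W x * (v x * (ta * A (3 * r) x ^+ m *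
     (C0 * k.*2.+2%:R * j / (3 * r)) * (3 * r <= gd x)%R%:R +
     A (3 * r) x ^+ k.+1.*2 * - time_cutoff' (T (3 * r)) k t))); last by ring.
  rewrite /err -[v x * _ * _%:R]mulrA; do 2 (rewrite ler_wpM2l//).
  set P := ramp t * _ in P0 h1 h2 *.
  set c1 := C0 * _ * j / _; set c2 := 4 * _ / _ in h2.
  have c10 : 0 <= c1 by rewrite divr_ge0 ?(ltW r30)// !mulr_ge0.
  have c20 : 0 <= c2 by rewrite divr_ge0 ?(ltW r30)// !mulr_ge0.
  have -> : vertex_rate / (3 * r) = c1 + c2 by rewrite mulrDl.
  have := ler_wpM2r c10 h1; have := mulr_ge0 P0 c10; have := mulr_ge0 P0 c20.
  by move: h2; case: (3 * r <= gd x); case: (T (3 * r) <= t) => /=; lra.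
have key : - \sum_(x \in S) muV W x * err x <= ta * Lap +
    \sum_(x \in S) muV W x * (v x *
      (A (3 * r) x ^+ k.+1.*2 * time_cutoff' (T (3 * r)) k t)).
  set TR := \sum_(x \in S) muV W x * (v x * _).
  have : ta * Bad - TR <= \sum_(x \in S) muV W x * err x.
    rewrite /Bad /TR !fsbig_finite// mulr_sumr -sumrB.
    by apply: ler_sum => x _; exact: err_ge.
  by move: hta; rewrite mulrN; lra.
have WE : \sum_(i < N) \sum_(x \in S)
      muV W x * weight (dyadic_radius theta1 (3 * r) i) (Vertex x) t =
    \sum_(x \in S) muV W x *
      \sum_(i < N) weight (dyadic_radius theta1 (3 * r) i) (Vertex x) t.
  under eq_bigr => i _ do rewrite fsbig_finite//.
  rewrite fsbig_finite// exchange_big/=; apply: eq_bigr => x _.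
  by rewrite mulr_sumr.
rewrite WE; apply: le_trans (lerD (lerD (lexx _) key) (lexx _)).
rewrite !fsbig_finite// !mulr_sumr -sumrN -!big_split/=.
apply: ler_sum => x _.
have := transition_absorption s1 th2 th12 cG coverN qk t0 r0 vertex_rate_ge0 l0
  (v0 x) (hpos (Vertex x) t0) (A0 r x) (space_cutoff_homo (gdist_ge0 _ _ cG) r0 _)
  (A1 (3 * r) x) (space_cutoff_eq0 r0) _.
rewrite -/(err x) -/(A r x) -/(A (3 * r) x) -/ta => H.
have rr : r <= 3 * r by lra.
have z3 : 9 * r < gd x -> A (3 * r) x = 0.
  by move=> ?; apply: space_cutoff_eq0 => //; lra.
move: (ler_wpM2l (ltW (muV_gt0 W x)) (H rr z3)).
set w := \sum_(i < N) _; move: (err x) w => E w.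
move: (lam `^ _) (_ `^ (sigma / _)) (h _ _ * _ `^ _) => Q1 Q2 Q3; lra.
Qed.
End VertexTransition.

Lemma integralG_eq0 (R : realType) (G : metricGraph R) (W : weights G)
    (f : gpoint G -> R) : (forall p, f p = 0) -> integralG W f = 0%E.
Proof.
move=> f0; have -> := @integralG_vertices _ _ W set0 f (@finite_set0 _)
  (fun x _ => f0 _) (fun e s => f0 _).
by rewrite fsbig_set0.
Qed.

(** A test function that vanishes at time 0 does not see the initial datum. *)
Lemma very_weak_ineq_ray (R : realType) (G : metricGraph R) (W : weights G)
    (h : gpoint G -> R -> R) (sigma : R) (u0 : gpoint G -> R)
    (u phi : gpoint G -> R -> R) :
  very_weak_solution W h sigma u0 u -> test_function phi ->
  (forall p, phi p 0 = 0) ->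
  let df t := integralG W (fun p => phi p t * laplacian W (u^~ t) p) in
  let r t := integralG W (fun p => h p t * `|u p t| `^ sigma * phi p t) in
  let tr t := integralG W (fun p => u p t * time_deriv phi p t) in
  [/\ lebesgue_measure.-integrable `[0, +oo[ df,
      lebesgue_measure.-integrable `[0, +oo[ r,
      lebesgue_measure.-integrable `[0, +oo[ tr &
      (\int[lebesgue_measure]_(t in `[0%R, +oo[) df t +
       \int[lebesgue_measure]_(t in `[0%R, +oo[) r t +
       \int[lebesgue_measure]_(t in `[0%R, +oo[) tr t <= 0)%E].
Proof.
move=> vws test phi0 df r tr.
have [[_ idf] [_ ir] [_ itr] _ le0] := vws_ineq vws test.
split; [exact: idf|exact: ir|exact: itr|].
have iz : integralG W (fun p => u0 p * phi p 0) = 0%E.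
  by apply: integralG_eq0 => p; rewrite phi0 mulr0.
have drop (a b : \bar R) : b = 0%E -> (a + b <= 0)%E -> (a <= 0)%E.
  by move=> ->; rewrite adde0.
exact: (drop _ _ iz le0).
Qed.

Section VertexVanishing.
Context {R : realType} {G : metricGraph R} (W : weights G).
Variables (x0 : vertex G) (h : gpoint G -> R -> R) (sigma theta1 theta2 : R).
Variables (j C0 C Rb : R) (u0 : gpoint G -> R) (u : gpoint G -> R -> R).
Hypotheses (s1 : 1 < sigma) (th2 : 1 <= theta2) (th12 : theta2 <= theta1).
Hypotheses (iV : infinite_set [set: vertex G]) (cG : gconnected G).
Hypotheses (j0 : 0 <= j) (lej : forall e : edge G, elen e <= j).
Hypothesis fin : forall r : R, 0 < r ->
  finitely_many_cells (gball (Vertex x0) r).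
Hypotheses (C00 : 0 <= C0) (Cge0 : 0 <= C).
Hypothesis omC0 : forall x : vertex G,
  \sum_(y \in [set y | adj x y]) omega W x y <= C0 * muV W x.
Hypothesis hpos : forall p t, 0 <= t -> 0 < h p t.
Hypothesis mh : edge_measurable h.
Local Notation weight r := (annulus_weight x0 h (sigma - 1)^-1 theta1 theta2 r).
Hypothesis weightV : forall r, Rb <= r ->
  (time_integral (fun t => \esum_(x in [set: vertex G])
     (muV W x * weight r (Vertex x) t)%:E) <=
   (C * r `^ (sigma / (sigma - 1)))%:E)%E.
Hypothesis vws : very_weak_solution W h sigma u0 u.
Hypothesis u_ge0 : forall p t, 0 <= t -> 0 <= u p t.

Local Notation T := (time_scale theta1 theta2).
Local Notation gd x := (gdist (Vertex x) (Vertex x0)).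
Local Notation D := (`[0%R, +oo[%classic : set R).

Lemma finite_vertex_ball (r : R) : 0 < r -> finite_set [set x | gd x <= r].
Proof.
move=> r0; have r10 : 0 < r + 1 by lra.
have [fV _] := fin r10; apply: sub_finite_set fV => x /= xr.
by rewrite /gball/=; lra.
Qed.

(** The test functions are carried by the vertices, so that all spatial
    integrals are finite sums over a ball and the absorption scheme applies
    with the bounds of vertex_transition.  Once all reaction integrals vanish,
    so does u wherever some cutoff is positive, that is at every vertex and
    almost every positive time. *)
Lemma vertex_vanishing :
  {ae lebesgue_measure, forall t : R, 0 <= t -> forall x, u (Vertex x) t = 0}.
Proof.
have [N coverN] := transition_cover th2 th12.
pose q := sigma / (sigma - 1).
have s10 : 0 < sigma - 1 by rewrite subr_gt0.
have q0 : 0 <= q by rewrite divr_ge0// ltW// (lt_trans ltr01).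
have [k qk] := exists_even_exponent q0.
pose rho := Num.max Rb (Num.max j 1).
have [rhoR rhoj rho1] : [/\ Rb <= rho, j <= rho & 1 <= rho].
  by rewrite /rho !le_max !lexx !orbT.
pose Rn := radius rho; pose RnS : forall n, Rn n.+1 = 3 * Rn n := radiusS rho.
have Rn_ge n : rho <= Rn n := radius_ge rho1 n.
have Rn0 n : 0 < Rn n := radius_gt0 rho1 n.
have T0 n : 0 < T (Rn n) by exact: time_scale_gt0.
have T_homo n : T (Rn n) <= T (Rn n.+1).
  by have := time_scale_triple th2 th12 (Rn0 n); rewrite -RnS; have := T0 n; lra.
have T_ge n : Rn n <= T (Rn n).
  by apply: le_time_scale => //; apply: le_trans (Rn_ge n); exact: rho1.
pose S n := [set x | gd x <= 4 * Rn n].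
have fS n : finite_set (S n) by apply: finite_vertex_ball; rewrite mulr_gt0.
(* The value 0 on open edges makes the edge integrals disappear. *)
pose al n (p : gpoint G) : R :=
  if p is Vertex x then space_cutoff (Rn n) (gd x) ^+ k.+1.*2 else 0.
pose phi n p t := al n p * time_cutoff (T (Rn n)) k t.
have test n : test_function (phi n).
  apply: (@test_function_cutoff _ _ _ _ _ (Vertex x0) (3 * Rn n)) => //.
  - move=> [x|e s]; rewrite /al ?lexx ?ler01//.
    by rewrite exprn_ge0 ?exprn_ile1 ?space_cutoff_ge0 ?space_cutoff_le1.
  - move=> [x|//] /ltW xR; rewrite /al space_cutoff_eq0//.
    by rewrite expr0n.
  - move=> e; apply: eq_measurable_fun (@measurable_cst _ _ _ _ _ (0 : R)) => s.
    by rewrite inE /= in_itv/= => s01; rewrite (epoint_inner s01).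
have phi0 n p : phi n p 0 = 0 by rewrite /phi time_cutoff0 mulr0.
pose df n t := integralG W (fun p => phi n p t * laplacian W (u^~ t) p).
pose r n t := integralG W (fun p => h p t * `|u p t| `^ sigma * phi n p t).
pose tr n t := integralG W (fun p => u p t * time_deriv (phi n) p t).
have test_ineq n := very_weak_ineq_ray vws (test n) (phi0 n).
have V n m (f : gpoint G -> R) : (n <= m)%N ->
    (forall p, al n p = 0 -> f p = 0) ->
    integralG W f = (\sum_(x \in S m) muV W x * f (Vertex x))%:E.
  move=> nm f0; apply: integralG_vertices => //; last by move=> e s; exact: f0.
  move=> x Sx; apply: f0; rewrite /al space_cutoff_eq0 ?expr0n//.
  rewrite leNgt; apply/negP => x3; apply: Sx; rewrite /S/=.
  by have := radius_homo rho1 nm; rewrite -/(Rn n) -/(Rn m); have := Rn0 n; lra.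
have rE n m t : (n <= m)%N -> 0 <= t -> r n t =
    (\sum_(x \in S m) muV W x * (h (Vertex x) t * u (Vertex x) t `^ sigma *
      (space_cutoff (Rn n) (gd x) ^+ k.+1.*2 * time_cutoff (T (Rn n)) k t)))%:E.
  move=> nm t0; rewrite /r (V n m)//.
    congr (_%:E); apply: eq_fsbigr => x _.
    by rewrite ger0_norm ?u_ge0.
  by move=> p ap; rewrite /phi ap mul0r mulr0.
have phi_ge0 n x t : 0 <= t ->
   0 <= space_cutoff (Rn n) (gd x) ^+ k.+1.*2 * time_cutoff (T (Rn n)) k t.
  move=> t0; rewrite mulr_ge0 ?time_cutoff_ge0//.
  by rewrite exprn_ge0 ?space_cutoff_ge0.
have react_ge0 x t : 0 <= t ->
    0 <= muV W x * (h (Vertex x) t * u (Vertex x) t `^ sigma).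
  move=> t0; rewrite mulr_ge0 ?(ltW (muV_gt0 W x))//.
  by rewrite mulr_ge0 ?powR_ge0// ltW// hpos.
have r_ge0 n t : D t -> (0 <= r n t)%E.
  rewrite /= in_itv/= andbT => t0; rewrite (rE n n)// lee_fin.
  rewrite fsbig_finite//; apply: sumr_ge0 => x _.
  by rewrite mulrA mulr_ge0 ?react_ge0 ?phi_ge0.
have r0 n : (\int[lebesgue_measure]_(t in D) r n t = 0)%E.
  pose w m rad t := (\sum_(x \in S m) muV W x * weight rad (Vertex x) t)%:E.
  pose g m t := (((vertex_rate j C0 k / Rn m) `^ q)%:E *
    \sum_(i < N) w m (dyadic_radius theta1 (Rn m) i) t)%E.
  have mw m rad : measurable_fun D (w m rad).
    apply/measurable_EFinP.
    rewrite (_ : (fun t => _) = fun t =>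
      \sum_(x <- finmap.enum_fset (fset_set (S m))) muV W x * weight rad (Vertex x) t); last first.
      by apply/funext => t; rewrite fsbig_finite.
    apply: measurable_sum => x; apply: measurable_funM => //.
    have [e [s s01 ->]] := vertex_epoint x cG iV.
    exact: measurable_annulus_weight_section.
  have wt0 rad x t : 0 <= muV W x * weight rad (Vertex x) t.
    by rewrite mulr_ge0 ?annulus_weight_ge0// ltW// muV_gt0.
  have w0 m rad t : D t -> (0 <= w m rad t)%E.
    by move=> _; rewrite lee_fin fsbig_finite//; apply: sumr_ge0.
  have wC m i : (\int[lebesgue_measure]_(t in D) w m (dyadic_radius theta1 (Rn m) i) t
      <= (C * dyadic_radius theta1 (Rn m) i `^ q)%:E)%E.
    set rad := dyadic_radius _ _ _.
    have radR : Rb <= rad.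
      apply: (le_trans rhoR); apply: (le_trans (Rn_ge m)).
      exact: (dyadic_radius_ge th2 th12 i (ltW (Rn0 m))).
    apply: le_trans (weightV radR); apply: ge0_le_integral_nonmeas.
      by move=> t Dt; exact: w0.
    move=> t _; rewrite /w -fsumEFin// -esum_fset//; last first.
      by move=> x _; rewrite lee_fin.
    rewrite esum_mkcond; apply: le_esum => x _.
    by case: ifPn => // _; rewrite lee_fin.
  apply: (@absorption_scheme R _ _ (@lebesgue_measure R) D
    (vertex_rate j C0 k `^ q * C * \sum_(i < N) ((2 ^+ i) `^ theta1^-1) `^ q)
    (sigma - 1)^-1 r df tr g) => //.
  - by rewrite invr_gt0.
  - rewrite !mulr_ge0 ?powR_ge0//; apply: sumr_ge0 => i _; exact: powR_ge0.
  - by move=> m; have [] := test_ineq m.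
  - by move=> m; have [] := test_ineq m.
  - by move=> m; have [] := test_ineq m.
  - move=> m; apply: emeasurable_funM => //; apply: emeasurable_sum => i.
    exact: mw.
  - move=> m t Dt; rewrite mule_ge0 ?lee_fin ?powR_ge0//.
    by apply: sume_ge0 => i _; exact: w0.
  - move=> m; apply: (dyadic_weight_integral (theta1 := theta1) (w := w m)) => //.
    + exact: vertex_rate_ge0.
    + by move=> i t; exact: w0.
  - move=> m; apply: aeW => t Dt; have t0 : 0 <= t.
      by move: Dt; rewrite /= in_itv/= andbT.
    rewrite (rE m m.+1 t (leqnSn m) t0) (rE m.+1 m.+1 t (leqnn _) t0) lee_fin.
    rewrite !fsbig_finite//; apply: ler_sum => x _.
    rewrite [leLHS]mulrA [leRHS]mulrA ler_wpM2l ?react_ge0//.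
    apply: ler_pM; rewrite ?exprn_ge0 ?space_cutoff_ge0 ?time_cutoff_ge0//.
    + apply: lerXn2r; rewrite ?nnegrE ?space_cutoff_ge0//.
      by rewrite space_cutoff_homo ?gdist_ge0// RnS; have := Rn0 m; lra.
    + exact: time_cutoff_homo.
  - by move=> m; have [] := test_ineq m.
  - move=> m lam lam0; apply: aeW => t Dt; have t0 : 0 <= t.
      by move: Dt; rewrite /= in_itv/= andbT.
    have dfE : df m.+1 t = (time_cutoff (T (Rn m.+1)) k t *
       \sum_(x \in S m.+1) space_cutoff (Rn m.+1) (gd x) ^+ k.+1.*2 *
       (\sum_(y \in [set y | adj x y]) omega W x y *
         (u (Vertex y) t - u (Vertex x) t)))%:E.
      rewrite /df (V m.+1 m.+1)//; last by move=> p ap; rewrite /phi ap !mul0r.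
      congr (_%:E); rewrite !fsbig_finite// mulr_sumr; apply: eq_bigr => x _.
      rewrite /phi /= /laplacianV.
      rewrite [RHS](_ : _ = muV W x * (muV W x)^-1 *
        (time_cutoff (T (Rn m.+1)) k t *
          (space_cutoff (Rn m.+1) (gd x) ^+ k.+1.*2 *
         \sum_(y \in [set y | adj x y]) omega W x y *
           (u (Vertex y) t - u (Vertex x) t)))); last first.
        by rewrite mulfV ?mul1r// gt_eqF// muV_gt0.
      ring.
    have trE : tr m.+1 t = (\sum_(x \in S m.+1) muV W x * (u (Vertex x) t *
       (space_cutoff (Rn m.+1) (gd x) ^+ k.+1.*2 *
         time_cutoff' (T (Rn m.+1)) k t)))%:E.
      rewrite /tr (V m.+1 m.+1)//.
        by congr (_%:E); apply: eq_fsbigr => x _; rewrite time_deriv_cutoff.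
      by move=> p ap; rewrite time_deriv_cutoff// ap mul0r mulr0.
    rewrite (rE m m.+1 t (leqnSn m) t0) (rE m.+1 m.+1 t (leqnn _) t0) dfE trE.
    rewrite /g /w sumEFin.
    rewrite -!EFinM -!EFinD lee_fin RnS.
    apply: (vertex_transition (lam := lam) (v := fun x => u (Vertex x) t)
      s1 th2 th12 cG j0 lej C00 omC0 hpos coverN qk) => //.
    + by rewrite -RnS (le_trans rhoj).
    + by rewrite -RnS (le_trans rho1).
    + by move=> x; rewrite -RnS.
    + by move=> x; exact: u_ge0.
have ir n : (@lebesgue_measure R).-integrable D (r n).
  by have [] := test_ineq n.
have r_ae : {ae (@lebesgue_measure R), forall t n, D t -> r n t = 0%E}.
  apply: ae_foralln => n.
  by apply: ge0_integral_eq0 (ir n) (r_ge0 n) (r0 n).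
apply: ae_imp2 r_ae (ae_lebesgue_neq (0 : R)) => t rt tn0 t0 x.
have tgt0 : 0 < t by rewrite lt_neqAle t0 andbT eq_sym; apply/eqP.
have [n nM] := radius_unbounded rho1 (Num.max (gd x) t).
move: nM; rewrite -/(Rn n) ge_max => /andP[xn tn].
have := rt n; rewrite /= in_itv/= t0 => /(_ isT).
rewrite (rE n n t (leqnn _) t0) => -[]; rewrite fsbig_finite// => /eqP.
rewrite psumr_eq0; last first.
  by move=> y _; rewrite mulrA mulr_ge0 ?react_ge0 ?phi_ge0.
move=> /allP/(_ x).
have := Rn0 n => Rnn.
have xS : gd x <= 4 * Rn n by lra.
rewrite in_fset_set// inE /S/= => /(_ xS).
rewrite space_cutoff_eq1//; last lra.
rewrite expr1n mul1r time_cutoff_eq_ramp//; last exact: le_trans (T_ge n).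
rewrite !mulf_eq0 (gt_eqF (muV_gt0 W x)) (gt_eqF (hpos _ t0)).
by rewrite (gt_eqF (ramp_gt0 tgt0)) orbF/= powR_eq0 => /andP[/eqP].
Qed.

End VertexVanishing.

(** * Second derivatives of nonnegative functions vanishing at the vertices *)

Section EndpointDerivatives.
Context {R : realType}.
Implicit Types (f : R -> R) (l s : R).

Lemma properfilter_within_itv l s : 0 < l -> 0 <= s <= l ->
  ProperFilter (within `[0, l] s^').
Proof.
move=> l0 /andP[s0 sl]; apply: Build_ProperFilter_ex => P [e /= e0 eP].
pose d := Num.min (e / 2) (l / 2).
have d0 : 0 < d by rewrite lt_min !divr_gt0.
have de : d < e.
  by apply: (@le_lt_trans _ _ (e / 2)); [rewrite ge_min lexx|lra].
have dl : d <= l / 2 by rewrite ge_min lexx orbT.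
have [sl2|sl2] := leP s (l / 2).
  exists (s + d); apply: eP => /=.
  - by rewrite opprD addNKr normrN gtr0_norm.
  - by rewrite gt_eqF// ltrDl.
  - by rewrite in_itv/=; apply/andP; split; lra.
exists (s - d); apply: eP => /=.
- by rewrite opprB addrC subrK gtr0_norm.
- by rewrite lt_eqF// gtrBl.
- by rewrite in_itv/=; apply/andP; split; lra.
Qed.

Lemma deriv_in_left_ge0 l f : 0 < l -> C1_in `[0, l] f ->
  f 0 = 0 -> (forall s, 0 <= s <= l -> 0 <= f s) -> 0 <= deriv_in `[0, l] f 0.
Proof.
move=> l0 [C1 _] f0 fge; have c0 := C1 0; rewrite /= in_itv/= lexx (ltW l0) in c0.
have PF := @properfilter_within_itv l 0 l0.
rewrite lexx (ltW l0) in PF; have {}PF := PF isT.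
apply: limr_ge; first exact: c0.
rewrite near_withinE; near=> y => yl.
have /andP[y0 y1] : 0 <= y <= l by move: yl; rewrite /= in_itv.
by rewrite f0 !subr0 divr_ge0// fge// y0.
Unshelve. all: by end_near. Qed.

Lemma deriv_in_right_le0 l f : 0 < l -> C1_in `[0, l] f ->
  f l = 0 -> (forall s, 0 <= s <= l -> 0 <= f s) -> deriv_in `[0, l] f l <= 0.
Proof.
move=> l0 [C1 _] f0 fge; have c0 := C1 l; rewrite /= in_itv/= lexx (ltW l0) in c0.
have PF := @properfilter_within_itv l l l0.
rewrite lexx (ltW l0) in PF; have {}PF := PF isT.
apply: limr_le; first exact: c0.
rewrite near_withinE; near=> y => yl.
have /andP[y0 y1] : 0 <= y <= l by move: yl; rewrite /= in_itv.
by rewrite f0 subr0 mulr_ge0_le0 ?invr_le0 ?subr_le0// fge// y0.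
Unshelve. all: by end_near. Qed.

Lemma deriv_in_inner l f s df : 0 < s < l ->
  is_derive s 1 f df -> deriv_in `[0, l] f s = df.
Proof.
move=> /andP[s0 sl] dfs; have PF : ProperFilter (within `[0, l] s^').
  by apply: properfilter_within_itv; rewrite ?(lt_trans s0)// !ltW.
by apply: cvg_lim => //; exact: cvg_deriv_in.
Qed.

(** The second derivative need not extend continuously to the ends, so the
    fundamental theorem is applied inside: the primitive of f'' minus f' has
    zero derivative on ]0, l[ and is continuous on [0, l], hence takes equal
    values at the ends. *)
Lemma integral_second_derivative l f : 0 < l ->
  C2_open 0 l f -> C1_in `[0, l] f ->
  lebesgue_measure.-integrable `]0, l[ (EFin \o derive1n 2 f) ->
  deriv_in `[0, l] f 0 = 0 -> deriv_in `[0, l] f l = 0 ->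
  (\int[lebesgue_measure]_(s in `]0%R, l[) (derive1n 2 f s)%:E = 0)%E.
Proof.
move=> l0 C2 [C1 cd] int2 d0 dl.
pose g := derive1n 2 f; pose mu := @lebesgue_measure R.
have mg : measurable_fun `]0%R, l[ (EFin \o g).
  exact: measurable_int int2.
have intc : mu.-integrable `[0, l] (EFin \o g).
  have /integrableP[_ fin2] := int2; apply/integrableP; split.
    exact: (@emeasurable_fun_itv_cc R 0 l false true _ mg).
  rewrite (integral_itv_bndoo true false)//.
  exact: measurableT_comp.
pose F x := parameterized_integral mu 0 x g.
have cF : {within `[0, l], continuous F}.
  by apply: parameterized_integral_continuous => //; exact: ltW.
pose H x := F x - deriv_in `[0, l] f x.
have cH : {within `[0, l], continuous H}.
  by move=> x; apply: cvgB; [exact: cF|exact: cd].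
have dH x : x \in `]0, l[ -> is_derive x 1 H 0.
  move=> xl; have [df1 df2 cf2] := C2 x xl.
  move: (xl); rewrite in_itv/= => /andP[x0 x1].
  have [dF FE] : derivable F x 1 /\ derive1 F x = g x.
    exact: (continuous_FTC1_closed x1 intc x0 cf2).
  have D1 : is_derive x 1 F (g x) := DeriveDef dF (etrans (esym (derive1E _ _)) FE).
  have D2 : is_derive x 1 (derive1 f) (g x) := DeriveDef df2 (esym (derive1E _ _)).
  have D3 : is_derive x 1 (fun y => F y - derive1 f y) 0.
    by apply: is_derive_eq; rewrite subrr.
  apply: near_eq_is_derive D3 => //.
  near=> y.
  have yl : y \in `]0, l[ by near: y; apply: near_in_itvoo.
  have [df1y _ _] := C2 y yl; rewrite /H; congr (_ - _).
  move: yl; rewrite in_itv/= => yl; apply/esym/(deriv_in_inner yl).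
  exact: (DeriveDef df1y (esym (derive1E _ _))).
have [c cl Hc] := MVT l0 dH cH.
have F0 : F 0 = 0 by rewrite /F /parameterized_integral set_itv1 Rintegral_set1.
have Fl : F l = 0 by move: Hc; rewrite mul0r /H F0 d0 dl; lra.
rewrite -(integral_itv_bndoo true false mg).
rewrite -[LHS]fineK ?integrable_fin_num// -[fine _]/(F l) Fl.
by [].
Unshelve. all: by end_near. Qed.

End EndpointDerivatives.

Section Kirchhoff.
Context {R : realType} {G : metricGraph R}.

(** A nonnegative function that vanishes at the ends of an edge has there
    normal derivatives of one sign; their sum at each vertex being 0, they all
    vanish.  A loop contributes two terms at its vertex, again of that sign. *)
Lemma kirchhoff_endpoint_derivs (f : gpoint G -> R) :
  locally_finite G -> domD f -> (forall p, 0 <= f p) ->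
  (forall x, f (Vertex x) = 0) -> (forall x, kirchhoff f x = 0) ->
  forall e, deriv_in `[0, elen e] (restr f e) 0 = 0 /\
            deriv_in `[0, elen e] (restr f e) (elen e) = 0.
Proof.
move=> lf dom f0 fV Kf.
have dini e : 0 <= deriv_in `[0, elen e] (restr f e) 0.
  have [_ _ C1 _] := dom e; apply: deriv_in_left_ge0 C1 _ _.
  - exact: elen_gt0.
  - by rewrite /restr epoint0.
  - by move=> s _; exact: f0.
have dter e : deriv_in `[0, elen e] (restr f e) (elen e) <= 0.
  have [_ _ C1 _] := dom e; apply: deriv_in_right_le0 C1 _ _.
  - exact: elen_gt0.
  - by rewrite /restr epoint_elen.
  - by move=> s _; exact: f0.
have nd0 x e : star x e -> normal_deriv f x e = 0.
  move=> xe; have := Kf x; rewrite /kirchhoff (fsbig_finite _ _ (lf x)).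
  move/eqP; rewrite -oppr_eq0 -sumrN psumr_eq0; last first.
    move=> e' _; rewrite oppr_ge0 /normal_deriv subr_le0.
    case: ifPn => _; case: ifPn => _ //; apply: le_trans (dini e') => //.
  move/allP => /(_ e); rewrite (in_fset_set (lf x)) inE.
  by move=> /(_ xe); rewrite oppr_eq0 => /eqP.
move=> e; have := dini e; have := dter e => tle ige.
have := nd0 (ini e) e (or_introl erefl); have := nd0 (ter e) e (or_intror erefl).
rewrite /normal_deriv !eqxx.
move: (deriv_in _ _ 0) (deriv_in _ _ (elen e)) ige tle => di dt di0 dt0.
by case: ifPn => _; case: ifPn => _ ? ?; split; lra.
Qed.

End Kirchhoff.

(** * Vanishing on the edges *)

Lemma very_weak_ae_integrable (R : realType) (G : metricGraph R) (W : weights G)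
    (h : gpoint G -> R -> R) (sigma : R) (u0 : gpoint G -> R)
    (u phi : gpoint G -> R -> R) :
  very_weak_solution W h sigma u0 u -> test_function phi ->
  [/\ {ae lebesgue_measure, forall t : R, 0 <= t ->
        integrableG W (fun p => phi p t * laplacian W (u^~ t) p)},
      {ae lebesgue_measure, forall t : R, 0 <= t ->
        integrableG W (fun p => h p t * `|u p t| `^ sigma * phi p t)} &
      {ae lebesgue_measure, forall t : R, 0 <= t ->
        integrableG W (fun p => u p t * time_deriv phi p t)}].
Proof.
move=> vws test.
by have [[aed _] [aer _] [aet _] _ _] := vws_ineq vws test; split.
Qed.

Section EdgeVanishing.
Context {R : realType} {G : metricGraph R} (W : weights G).
Variables (x0 : vertex G) (h : gpoint G -> R -> R) (sigma theta1 theta2 : R).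
Variables (C Rb : R) (u0 : gpoint G -> R) (u : gpoint G -> R -> R).
Hypotheses (s1 : 1 < sigma) (th2 : 1 <= theta2) (th12 : theta2 <= theta1).
Hypotheses (cG : gconnected G) (lf : locally_finite G).
Hypothesis fin : forall r : R, 0 < r ->
  finitely_many_cells (gball (Vertex x0) r).
Hypothesis Cge0 : 0 <= C.
Hypothesis hpos : forall p t, 0 <= t -> 0 < h p t.
Hypothesis mh : edge_measurable h.
Local Notation weight r := (annulus_weight x0 h (sigma - 1)^-1 theta1 theta2 r).
Hypothesis weightE : forall r, Rb <= r ->
  (time_integral (fun t => \esum_(e in [set: edge G])
    \int[lebesgue_measure]_(s in `]0%R, elen e[) (weight r (epoint e s) t)%:E) <=
   (C * r `^ (sigma / (sigma - 1)))%:E)%E.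
Hypothesis vws : very_weak_solution W h sigma u0 u.
Hypothesis u_ge0 : forall p t, 0 <= t -> 0 <= u p t.
Hypothesis uV : {ae lebesgue_measure, forall t : R, 0 <= t ->
  forall x, u (Vertex x) t = 0}.

Local Notation T := (time_scale theta1 theta2).
Local Notation gd p := (gdist p (Vertex x0)).
Local Notation D := (`[0%R, +oo[%classic : set R).

(** The test function is the cutoff in time on the open edge e and 0 elsewhere.
    At almost every time its diffusion integral is a multiple of the integral of
    u'' over e, which is 0 by the Kirchhoff condition, and the absorption scheme
    applies with the transport error only. *)
Lemma edge_vanishing (e : edge G) : {ae lebesgue_measure, forall t : R, 0 <= t ->
  forall s, 0 < s < elen e -> u (epoint e s) t = 0}.
Proof.
have [N coverN] := transition_cover th2 th12.
pose q := sigma / (sigma - 1).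
have s10 : 0 < sigma - 1 by rewrite subr_gt0.
have q0 : 0 <= q by rewrite divr_ge0// ltW// (lt_trans ltr01).
have [k qk] := exists_even_exponent q0.
pose dE := gd (Vertex (ini e)) + elen e.
have gdE s : 0 <= s <= elen e -> gd (epoint e s) <= dE.
  move=> sl; have p : gpath (epoint e s) (epoint e 0) (`|s - 0| + 0).
    by apply: gpathS; [|rewrite lexx ltW ?elen_gt0|exact: gpath0].
  apply: le_trans (gdist_le_gpath _ cG p) _; rewrite subr0 addr0 epoint0 addrC.
  by case/andP: sl => sl0 sl; rewrite lerD2l ger0_norm.
(* The whole edge lies at distance less than the smallest radius, where the
   cutoff in space would be 1. *)
pose rho := Num.max Rb (Num.max (dE + 1) 1).
have [rhoR rhoE rho1] : [/\ Rb <= rho, dE + 1 <= rho & 1 <= rho].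
  by rewrite /rho !le_max !lexx !orbT.
pose Rn := radius rho; pose RnS : forall n, Rn n.+1 = 3 * Rn n := radiusS rho.
have Rn_ge n : rho <= Rn n := radius_ge rho1 n.
have Rn0 n : 0 < Rn n := radius_gt0 rho1 n.
have T0 n : 0 < T (Rn n) by exact: time_scale_gt0.
have T_homo n : T (Rn n) <= T (Rn n.+1).
  by have := time_scale_triple th2 th12 (Rn0 n); rewrite -RnS; have := T0 n; lra.
have T_ge n : Rn n <= T (Rn n).
  by apply: le_time_scale => //; apply: le_trans (Rn_ge n); exact: rho1.
pose al (p : gpoint G) : R := if p is Inner e' _ then (e' == e)%:R else 0.
have alE s : 0 < s < elen e -> al (epoint e s) = 1.
  by move=> sl; rewrite (epoint_inner sl) /= eqxx.
pose phi n p t := al p * time_cutoff (T (Rn n)) k t.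
have test n : test_function (phi n).
  apply: (@test_function_cutoff _ _ _ _ _ (Vertex x0) dE) => //.
  - by move=> [x|e' s]; rewrite /al ?lexx ?ler01// ler0n lern1 leq_b1.
  - move=> [//|e' s] /=; case: eqP => // ee; subst e'.
    rewrite -epoint_val ltNge gdE//; case: s => s /= /andP[? ?].
    by rewrite !ltW.
  - move=> e'; apply: eq_measurable_fun
      (@measurable_cst _ _ _ _ _ ((e' == e)%:R : R)) => s.
    by rewrite inE /= in_itv/= => s01; rewrite (epoint_inner s01).
have phi0 n p : phi n p 0 = 0 by rewrite /phi time_cutoff0 mulr0.
pose df n t := integralG W (fun p => phi n p t * laplacian W (u^~ t) p).
pose r n t := integralG W (fun p => h p t * `|u p t| `^ sigma * phi n p t).
pose tr n t := integralG W (fun p => u p t * time_deriv (phi n) p t).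
have test_ineq n := very_weak_ineq_ray vws (test n) (phi0 n).
have V (f F : gpoint G -> R) : (forall p, al p = 0 -> f p = 0) ->
    (forall s, 0 < s < elen e -> restr f e s = restr F e s) ->
    (integralG W f = \int[lebesgue_measure]_(s in `]0%R, elen e[) (restr F e s)%:E)%E.
  move=> f0 fF; rewrite (@integralG_edge _ _ W e).
  - by apply: eq_integral => s; rewrite inE/= in_itv/= => /fF ->.
  - by move=> x; exact: f0.
  - by move=> e' s /eqP ee; apply: f0; rewrite /= (negPf ee).
pose fr n t p := h p t * u p t `^ sigma * time_cutoff (T (Rn n)) k t.
pose ft n t p := u p t * time_cutoff' (T (Rn n)) k t.
have rE n t : 0 <= t -> (r n t =
    \int[lebesgue_measure]_(s in `]0%R, elen e[) (restr (fr n t) e s)%:E)%E.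
  move=> t0; apply: V => [p ap|s sl]; first by rewrite /phi ap mul0r mulr0.
  by rewrite /restr /fr /phi alE// mul1r ger0_norm// u_ge0.
have trE n t : 0 <= t -> (tr n t =
    \int[lebesgue_measure]_(s in `]0%R, elen e[) (restr (ft n t) e s)%:E)%E.
  move=> t0; apply: V => [p ap|s sl].
    by rewrite time_deriv_cutoff// ap mul0r mulr0.
  by rewrite /restr /ft time_deriv_cutoff// alE// mul1r.
pose I : set R := `]0, elen e[%classic.
have mI : measurable I by exact: measurable_itv.
have memI s : s \in I -> 0 < s < elen e by rewrite inE /I /= in_itv.
have Vint (f F : gpoint G -> R) : integrableG W f ->
    (forall s, 0 < s < elen e -> restr f e s = restr F e s) ->
    lebesgue_measure.-integrable I (EFin \o restr F e).
  move=> [_ intf _] fF; apply: eq_integrable (intf e) => // s /memI /fF.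
  by rewrite /= => ->.
have phiE n t s : 0 < s < elen e -> phi n (epoint e s) t = time_cutoff (T (Rn n)) k t.
  by move=> sl; rewrite /phi alE// mul1r.
have ae_df n : {ae (@lebesgue_measure R), forall t, 0 <= t -> df n t = 0%E}.
  have [aed _ _] := very_weak_ae_integrable vws (test n).
  apply: ae_imp2 uV aed => t uVt intt t0.
  pose ta := time_cutoff (T (Rn n)) k t.
  pose g2 := derive1n 2 (restr (u^~ t) e).
  have lapE s : 0 < s < elen e -> laplacian W (u^~ t) (epoint e s) = g2 s.
    by move=> sl; rewrite (epoint_inner sl).
  have -> : (df n t = \int[lebesgue_measure]_(s in `]0%R, elen e[) (ta * g2 s)%:E)%E.
    rewrite /df (V _ (fun p => ta * laplacian W (u^~ t) p)).
    - by apply: eq_integral => s /memI /lapE sl; rewrite /restr sl.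
    - by move=> p ap; rewrite /phi ap !mul0r.
    - by move=> s sl; rewrite /restr phiE.
  have [ta0|tan0] := eqVneq ta 0.
    by rewrite integral0_eq// => s _; rewrite ta0 mul0r.
  have intg : lebesgue_measure.-integrable `]0, elen e[ (EFin \o g2).
    have int1 : lebesgue_measure.-integrable I
        (EFin \o restr (fun p => ta * laplacian W (u^~ t) p) e).
      by apply: Vint (intt t0) _ => s sl; rewrite /restr phiE.
    set Lap := restr _ e in int1.
    have int2 : lebesgue_measure.-integrable I
        (fun s => ((ta^-1)%:E * (EFin \o Lap) s)%E).
      exact: integrableZl.
    apply: eq_integrable int2 => // s /memI sl /=.
    by rewrite /Lap /restr lapE// -EFinM mulrA mulVf// mul1r.
  have [dom1 dom2] : domD (u^~ t) /\ forall x, kirchhoff (u^~ t) x = 0.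
    by split; [exact: (vws_regular vws)|exact: (vws_kirchhoff vws)].
  have [di dt] := kirchhoff_endpoint_derivs lf dom1
    (fun p => u_ge0 p t0) (uVt t0) dom2 e.
  have [_ C2 C1 _] := dom1 e.
  have g20 := integral_second_derivative (elen_gt0 e) C2 C1 intg di dt.
  under eq_integral => s _ do rewrite EFinM.
  by rewrite integralZl// g20 mule0.
have fr_ge0 n t p : 0 <= t -> 0 <= fr n t p.
  move=> t0; rewrite mulr_ge0 ?time_cutoff_ge0//.
  by rewrite mulr_ge0 ?powR_ge0// ltW// hpos.
have Dt0 t : D t -> 0 <= t by rewrite /= in_itv/= andbT.
have r_ge0 n t : D t -> (0 <= r n t)%E.
  move=> /Dt0 t0; rewrite rE//; apply: integral_ge0 => s _.
  by rewrite lee_fin; exact: fr_ge0.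
have r0 n : (\int[lebesgue_measure]_(t in D) r n t = 0)%E.
  pose w rad t := (\int[lebesgue_measure]_(s in `]0%R, elen e[)
    (weight rad (epoint e s) t)%:E)%E.
  pose kap : R := 4 * k.+1%:R.
  have kap0 : 0 < kap by rewrite mulr_gt0.
  pose g m t := (((kap / Rn m) `^ q)%:E *
    \sum_(i < N) w (dyadic_radius theta1 (Rn m) i) t)%E.
  have mw rad : measurable_fun D (w rad).
    exact: measurable_integral_annulus_weight.
  have w0 rad t : D t -> (0 <= w rad t)%E.
    by move=> _; apply: integral_ge0 => s _; rewrite lee_fin annulus_weight_ge0.
  have wC m i : (\int[lebesgue_measure]_(t in D) w (dyadic_radius theta1 (Rn m) i) t
      <= (C * dyadic_radius theta1 (Rn m) i `^ q)%:E)%E.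
    set rad := dyadic_radius _ _ _.
    have radR : Rb <= rad.
      apply: (le_trans rhoR); apply: (le_trans (Rn_ge m)).
      exact: (dyadic_radius_ge th2 th12 i (ltW (Rn0 m))).
    apply: le_trans (weightE radR); apply: ge0_le_integral_nonmeas.
      by move=> t Dt; exact: w0.
    move=> t Dt; pose B e' := (\int[lebesgue_measure]_(s in `]0%R, elen e'[)
        (weight rad (epoint e' s) t)%:E)%E.
    have B0 e' : (0 <= B e')%E.
      by apply: integral_ge0 => s _; rewrite lee_fin annulus_weight_ge0.
    suff : (B e <= \esum_(e' in [set: edge G]) B e')%E by [].
    rewrite -(@esum_set1 _ _ e B)// esum_mkcond; apply: le_esum => e' _.
    by case: ifPn.
  apply: (@absorption_scheme R _ _ (@lebesgue_measure R) D
    (kap `^ q * C * \sum_(i < N) ((2 ^+ i) `^ theta1^-1) `^ q)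
    (sigma - 1)^-1 r df tr g) => //.
  - by rewrite invr_gt0.
  - rewrite !mulr_ge0 ?powR_ge0//; apply: sumr_ge0 => i _; exact: powR_ge0.
  - by move=> m; have [] := test_ineq m.
  - by move=> m; have [] := test_ineq m.
  - by move=> m; have [] := test_ineq m.
  - move=> m; apply: emeasurable_funM => //; apply: emeasurable_sum => i.
    exact: mw.
  - move=> m t Dt; rewrite mule_ge0 ?lee_fin ?powR_ge0//.
    by apply: sume_ge0 => i _; exact: w0.
  - move=> m; apply: (dyadic_weight_integral (theta1 := theta1) (w := w)) => //.
    + exact: ltW.
    + by move=> i t; exact: w0.
  - move=> m; apply: aeW => t /Dt0 t0.
    rewrite (rE m t t0) (rE m.+1 t t0).
    apply: ge0_le_integral_nonmeas => s _; rewrite lee_fin; first exact: fr_ge0.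
    rewrite ler_wpM2l//; last exact: time_cutoff_homo.
    by rewrite mulr_ge0 ?powR_ge0// ltW// hpos.
  - by move=> m; have [] := test_ineq m.
  - move=> m lam lam0.
    have [_ aerS aetS] := very_weak_ae_integrable vws (test m.+1).
    have [_ aer _] := very_weak_ae_integrable vws (test m).
    have aeA := ae_imp2 (fun t => @conj _ _) aer aerS.
    have aeB := ae_imp2 (fun t => @conj _ _) aetS (ae_df m.+1).
    apply: ae_imp2 aeA aeB => t [i1 i2] [i3 df0] /Dt0 t0.
    have rint n' : integrableG W (fun p => h p t * `|u p t| `^ sigma * phi n' p t) ->
        (@lebesgue_measure R).-integrable I (EFin \o restr (fr n' t) e).
      move=> i; apply: Vint i _ => s sl.
      by rewrite /restr phiE// /fr ger0_norm// u_ge0.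
    have J1 := rint _ (i1 t0); have J2 := rint _ (i2 t0).
    have J3 : (@lebesgue_measure R).-integrable I (EFin \o restr (ft m.+1 t) e).
      apply: Vint (i3 t0) _ => s sl.
      by rewrite /restr time_deriv_cutoff// alE// mul1r.
    pose rad i := dyadic_radius theta1 (Rn m.+1) i.
    pose ws s := \sum_(i < N) weight (rad i) (epoint e s) t.
    pose c := (kap / Rn m.+1) `^ q.
    pose Q := lam `^ (- (sigma - 1)^-1).
    have c0 : 0 < c by rewrite powR_gt0// divr_gt0.
    have Q0 : 0 < Q by rewrite powR_gt0.
    have mwi i : measurable_fun I (fun s => weight (rad i) (epoint e s) t).
      exact: measurable_annulus_weight_time.
    have mws : measurable_fun I (EFin \o ws).
      by apply/measurable_EFinP; apply: measurable_sum => i; exact: mwi.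
    have ws0 s : 0 <= ws s by apply: sumr_ge0 => i _; exact: annulus_weight_ge0.
    have gE : (g m.+1 t = c%:E * \int[lebesgue_measure]_(s in I) (ws s)%:E)%E.
      rewrite /g -/c; congr (_ * _)%E; rewrite /w.
      rewrite -ge0_integral_sum//.
      - by apply: eq_integral => s _; rewrite sumEFin.
      - by move=> i; apply/measurable_EFinP; exact: mwi.
      - by move=> i s _; rewrite lee_fin annulus_weight_ge0.
    rewrite (df0 t0) add0e (rE m t t0) (rE m.+1 t t0) (trE m.+1 t t0) gE.
    pose r2 := (\int[lebesgue_measure]_(s in `]0%R, elen e[)
      (restr (fr m.+1 t) e s)%:E)%E.
    pose r3 := (\int[lebesgue_measure]_(s in `]0%R, elen e[)
      (restr (ft m.+1 t) e s)%:E)%E.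
    rewrite -/r2 -/r3.
    have f2 : r2 \is a fin_num by exact: integrable_fin_num J2.
    have f3 : r3 \is a fin_num by exact: integrable_fin_num J3.
    (* The weight may be infinite at some times; the bound is then trivial. *)
    have [Wfin|] := ltP (\int[lebesgue_measure]_(s in I) (ws s)%:E)%E +oo%E;
      last first.
      rewrite leye_eq => /eqP ->.
      rewrite gt0_muley ?lte_fin// gt0_muley ?lte_fin// addey ?leey//.
      have : (lam%:E * r2 + r3)%E \is a fin_num by rewrite fin_numD fin_numM.
      by rewrite fin_numE => /andP[].
    have J4 : (@lebesgue_measure R).-integrable I (EFin \o ws).
      apply/integrableP; split=> //.
      by under eq_integral => s _ do rewrite /= ger0_norm//.
    have K1 : (@lebesgue_measure R).-integrable I
        (fun s => lam%:E * (EFin \o restr (fr m t) e) s)%E.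
      exact: integrableZl.
    have K2 : (@lebesgue_measure R).-integrable I
        (fun s => lam%:E * (EFin \o restr (fr m.+1 t) e) s)%E.
      exact: integrableZl.
    have K3 : (@lebesgue_measure R).-integrable I
        (fun s => (Q * c)%:E * (EFin \o ws) s)%E.
      exact: integrableZl.
    have K23 : (@lebesgue_measure R).-integrable I
        (fun s => lam%:E * (EFin \o restr (fr m.+1 t) e) s +
          (EFin \o restr (ft m.+1 t) e) s)%E.
      exact: integrableD.
    have K : (@lebesgue_measure R).-integrable I
        (fun s => lam%:E * (EFin \o restr (fr m.+1 t) e) s +
          (EFin \o restr (ft m.+1 t) e) s + (Q * c)%:E * (EFin \o ws) s)%E.
      exact: integrableD.
    suff : (\int[lebesgue_measure]_(s in I)
              (lam%:E * (EFin \o restr (fr m t) e) s) <=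
            \int[lebesgue_measure]_(s in I)
              (lam%:E * (EFin \o restr (fr m.+1 t) e) s +
               (EFin \o restr (ft m.+1 t) e) s +
               (Q * c)%:E * (EFin \o ws) s))%E.
      by rewrite integralD// integralD// !integralZl// EFinM -muleA.
    apply: le_integral => //.
    move=> s /memI sl.
    rewrite /= -!EFinM -!EFinD lee_fin /restr.
    have gds : gd (epoint e s) < Rn m.
      apply: (@le_lt_trans _ _ dE).
        by apply: gdE; case/andP: sl => ? ?; rewrite !ltW.
      by apply: lt_le_trans (Rn_ge m); apply: lt_le_trans rhoE; rewrite ltrDl.
    have Rm := Rn0 m; have us0 := u_ge0 (epoint e s) t0.
    have far (a : R) : 1 <= a -> (a * Rn m <= gd (epoint e s)) = false.
      by move=> a1; apply/negbTE; rewrite -ltNge (lt_le_trans gds)// ler_peMl// ltW.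
    have H := @transition_absorption _ _ x0 h sigma theta1 theta2 N k
      s1 th2 th12 cG coverN qk (epoint e s) t (Rn m) kap lam (u (epoint e s) t) 1 1
      t0 Rm (ltW kap0) lam0 us0 (hpos (epoint e s) t0) ler01 (lexx _) (lexx _).
    have A1 : 3 * Rn m <= gd (epoint e s) -> 1 = 0 :> R by rewrite far ?ler1n.
    have A2 : 9 * Rn m < gd (epoint e s) -> 1 = 0 :> R.
      by move=> /ltW; rewrite far ?ler1n.
    move: {H}(H A1 A2); rewrite !expr1n !mul1r -RnS -/(ws s) -/c -/Q => H.
    have RS0 := Rn0 m.+1; have TS0 := T0 m.+1; have RT := T_ge m.+1.
    have h3 : - time_cutoff' (T (Rn m.+1)) k t <=
        ramp t * plateau (T (Rn m.+1)) t ^+ k.*2.+1 * (kap / Rn m.+1) *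
        ((Rn m.+1 <= gd (epoint e s)) || (T (Rn m.+1) <= t))%R%:R.
      apply: (le_trans (time_cutoff'_ge k t0 TS0)); rewrite -/kap.
      have P0 : 0 <= ramp t * plateau (T (Rn m.+1)) t ^+ k.*2.+1.
        by rewrite mulr_ge0 ?ramp_ge0 ?plateauX_ge0.
      apply: ler_pM; rewrite ?ler0n//.
      + by rewrite mulr_ge0// divr_ge0// ltW.
      + by rewrite ler_wpM2l// ler_wpM2l ?(ltW kap0)// lef_pV2.
      + by case: (T _ <= t); rewrite ?orbT// ler0n.
    have := ler_wpM2l us0 h3; rewrite /fr /ft.
    move: H; clear; lra.
have ir n : (@lebesgue_measure R).-integrable D (r n).
  by have [] := test_ineq n.
have r_ae : {ae (@lebesgue_measure R), forall t n, D t -> r n t = 0%E}.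
  apply: ae_foralln => n.
  by apply: ge0_integral_eq0 (ir n) (r_ge0 n) (r0 n).
have r_int : {ae (@lebesgue_measure R), forall t n, 0 <= t ->
    integrableG W (fun p => h p t * `|u p t| `^ sigma * phi n p t)}.
  apply: ae_foralln => n.
  by have [_ aer _] := very_weak_ae_integrable vws (test n).
have rr_ae := ae_imp2 (fun t => @conj _ _) r_ae r_int.
apply: ae_imp2 rr_ae (ae_lebesgue_neq (0 : R)) => t [rt intt] tn0 t0.
have tgt0 : 0 < t by rewrite lt_neqAle t0 andbT eq_sym; apply/eqP.
have [n tn] := radius_unbounded rho1 t.
have taE : time_cutoff (T (Rn n)) k t = ramp t.
  by rewrite time_cutoff_eq_ramp//; exact: le_trans (T_ge n).
have := rt n; rewrite /= in_itv/= t0 => /(_ isT); rewrite rE// => fr0.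
have intfr : (@lebesgue_measure R).-integrable I (EFin \o restr (fr n t) e).
  apply: Vint (intt n t0) _ => s sl.
  by rewrite /restr phiE// /fr ger0_norm// u_ge0.
have ae0 : {ae (@lebesgue_measure R), forall s, I s -> u (epoint e s) t = 0}.
  have : {ae (@lebesgue_measure R), forall s, I s -> (restr (fr n t) e s)%:E = 0%E}.
    apply: ge0_integral_eq0 intfr _ fr0 => //.
    by move=> s _; rewrite lee_fin fr_ge0.
  move=> H; apply: (ae_imp2 _ H H) => s Hs _ /Hs [].
  move/eqP; rewrite /restr /fr taE !mulf_eq0 (gt_eqF (hpos _ t0)).
  by rewrite (gt_eqF (ramp_gt0 tgt0)) orbF/= powR_eq0 => /andP[/eqP].
move=> s sl; apply: (ae_eq0_continuous _ ae0); last by rewrite in_itv.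
move=> s' s'l; have [_ C2 _ _] := vws_regular vws t0 e.
have [d1 _ _] := C2 s' s'l.
by apply: differentiable_continuous; apply/derivable1_diffP.
Qed.

End EdgeVanishing.

(** * The Liouville theorem *)

Unset Implicit Arguments.
Set Strict Implicit.

Theorem theorem2p2 (R : realType) (G : metricGraph R) (W : weights G)
    (x0 : vertex G) (h : gpoint G -> R -> R) (sigma theta1 theta2 : R) :
  infinite_set [set: vertex G] ->
  gconnected G ->
  locally_finite G ->
  has_ubound [set elen e | e in [set: edge G]] ->
  0 < inf [set elen e | e in [set: edge G]] ->
  (exists x_ : nat -> vertex G,
    gdist (Vertex x0) (Vertex (x_ n)) @[n --> \oo] --> +oo) ->
  (forall r : R, 0 < r -> finitely_many_cells (gball (Vertex x0) r)) ->
  (exists2 C0 : R, 0 < C0 & forall x : vertex G,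
    \sum_(y \in [set y | adj x y]) omega W x y <= C0 * muV W x) ->
  (forall p t, 0 <= t -> 0 < h p t) ->
  edge_measurable h ->
  1 < sigma -> 2 <= theta1 -> 1 <= theta2 -> theta2 <= theta1 ->
  let j := sup [set elen e | e in [set: edge G]] in
  let R0 := Num.max (2 * j) 1 in
  let E := annulus x0 theta1 theta2 in
  let H (r : R) (p : gpoint G) (t : R) :=
    h p t `^ (- (sigma - 1)^-1) * \1_(E r) (p, t) in
  (exists2 C : R, 0 < C & forall r : R, R0 <= r ->
    (time_integral (fun t => \esum_(x in [set: vertex G])
        (muV W x * H r (Vertex x) t)%:E)
      <= (C * r `^ (sigma / (sigma - 1)))%:E)%E /\
    (time_integral (fun t => \esum_(e in [set: edge G])
        \int[lebesgue_measure]_(s in `]0%R, elen e[) (H r (epoint e s) t)%:E)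
      <= (C * r `^ (sigma / (sigma - 1)))%:E)%E) ->
  forall (u0 : gpoint G -> R) (u : gpoint G -> R -> R),
  very_weak_solution W h sigma u0 u ->
  (forall p t, 0 <= t -> 0 <= u p t) ->
  {ae lebesgue_measure, forall t : R, 0 <= t -> forall p, u p t = 0}.
Proof.
move=> iV cG lf ub _ _ fin [C0 C00 omC0] hpos mh s1 _ th2 th12 j R0 E H.
move=> [C Cgt0 weightC] u0 u vws u_ge0.
have lej (e : edge G) : elen e <= j by apply: ub_le_sup => //; exists e.
have j0 : 0 <= j.
  have [e _] := vertex_epoint x0 cG iV.
  by apply: le_trans (lej e); exact/ltW/elen_gt0.
have uV : {ae lebesgue_measure, forall t : R, 0 <= t ->
    forall x, u (Vertex x) t = 0}.
  apply: (@vertex_vanishing R G W x0 h sigma theta1 theta2 j C0 C R0 u0 u) => //.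
  - exact: ltW.
  - exact: ltW.
  - by move=> r rR; have [] := weightC r rR.
have uE : {ae lebesgue_measure, forall t : R, forall e : edge G, 0 <= t ->
    forall s, 0 < s < elen e -> u (epoint e s) t = 0}.
  apply: ae_forall_count => e.
  apply: (@edge_vanishing R G W x0 h sigma theta1 theta2 C R0 u0 u) => //.
  - exact: ltW.
  - by move=> r rR; have [] := weightC r rR.
apply: ae_imp2 uV uE => t uVt uEt t0 [x|e s]; first exact: uVt.
by rewrite -epoint_val; apply: uEt => //; case: s.
Qed.
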